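(* Let $\mathcal{O}_X$ be a local Gorenstein ring and $I_D=(f_1,\dots,f_r)\subset\mathcal{O}_X$ an ideal of codimension one such that the quotient ring $\mathcal{O}_D=\mathcal{O}_X/I_D$ is also Gorenstein. Let $\widetilde{s}\colon I_D\to\mathcal{O}_X$ be an injective $\mathcal{O}_X$-homomorphism whose class generates the $\mathcal{O}_X$-module $\operatorname{Hom}_{\mathcal{O}_X}(I_D,\mathcal{O}_X)/\mathcal{O}_X$, and set $g_j=\widetilde{s}(f_j)\in\mathcal{O}_X$ for $1\le j\le r$. Let $\mathcal{O}_X[S]$ be the polynomial ring in one variable, and let $\psi^2\colon \mathcal{O}_X[S]\to\operatorname{unpr}_{\mathcal{O}_X}I_D$ be the (surjective) $\mathcal{O}_X$-algebra homomorphism sending $S$ to the class of $\widetilde{s}$. Then $$\ker\psi^2=(Sf_j-g_j : 1\le j\le r)\subset\mathcal{O}_X[S].$$ As a consequence, $\operatorname{unpr}_{\mathcal{O}_X}I_D$ is isomorphic, as an $\mathcal{O}_X$-algebra, to the Kustin--Miller unprojection ring $\mathcal{O}_X[S]/(Sf_j-g_j : 1\le j\le r)$, and $\operatorname{unpr}_{\mathcal{O}_X}I_D\cong R_1$.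
   Context: Rings are commutative with unit. $\mathcal{O}_X$ is regarded as a submodule of $\operatorname{Hom}_{\mathcal{O}_X}(I_D,\mathcal{O}_X)$ by sending $a\in\mathcal{O}_X$ to multiplication by $a$. Let $R=\operatorname{Sym}_{\mathcal{O}_X}\operatorname{Hom}_{\mathcal{O}_X}(I_D,\mathcal{O}_X)$ be the symmetric algebra of the $\mathcal{O}_X$-module $\operatorname{Hom}_{\mathcal{O}_X}(I_D,\mathcal{O}_X)$. Let $i\in\operatorname{Hom}_{\mathcal{O}_X}(I_D,\mathcal{O}_X)$ be the inclusion map $I_D\to\mathcal{O}_X$, viewed as a degree $1$ element of $R$, and let $1\in R$ be the unit of $R$. Set $R_1=R/(i-1)$. For an $\mathcal{O}_X$-module $N$, an element $t\in\mathcal{O}_X$ is called $N$-regular if $tn\neq 0$ for every nonzero $n\in N$. Let $T=\{t\in\mathcal{O}_X : t \text{ is both } \mathcal{O}_X\text{-regular and } \mathcal{O}_D\text{-regular}\}$, and let $J=\{u\in R_1 : \text{there exists } t\in T \text{ with } tu=0 \text{ in } R_1\}$. The unprojection algebra of the ideal $I_D\subset\mathcal{O}_X$ is the $\mathcal{O}_X$-algebra $\operatorname{unpr}_{\mathcal{O}_X}I_D=R_1/J$. *)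

(* Defs.v *)
From HB Require Import structures.
From mathcomp Require Import all_boot all_algebra.
From mathcomp Require Import boolp classical_sets.
From mathcomp Require Import monalg.

Set Implicit Arguments.
Unset Strict Implicit.
Unset Printing Implicit Defensive.

Import GRing.Theory.

Local Open Scope classical_set_scope.
Local Open Scope ring_scope.
Local Open Scope quotient_scope.

(* MathComp's [idealr] only covers proper ideals of nonzero rings.  Here       *)
(* submodules and ideals are arbitrary ([submodClosed] predicates), and the    *)
(* quotient rings are [pzRing]s, which need not be nonzero.                    *)

Section SubmoduleType.
Variables (R : pzRingType) (V : lmodType R) (N : submodClosed V).

Record submodule := SubmoduleElt {
  submodule_val : V;
  submodule_valP : submodule_val \in N }.

HB.instance Definition _ := [isSub for submodule_val].
HB.instance Definition _ := [Choice of submodule by <:].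
HB.instance Definition _ := GRing.SubChoice_isSubLmodule.Build R V _ submodule
  (GRing.subsemimodClosedP N).

(* [submodClosed] predicates have no canonical [zmodClosed] structure over a   *)
(* ring; this wrapper provides it.                                             *)
Definition submodule_pred : {pred V} := fun v => v \in N.

HB.instance Definition _ := GRing.isSubmodClosed.Build R V submodule_pred
  (GRing.subsemimodClosedP N).

End SubmoduleType.

Section QuotientModule.
Variables (R : pzRingType) (V : lmodType R) (N : submodClosed V).

Definition quotient_module : Type := Quotient.quot (submodule_pred N).
HB.instance Definition _ := GRing.Zmodule.on quotient_module.

Definition quotient_pi (v : V) : quotient_module := \pi_quotient_module v.

Lemma quotient_piP (q : quotient_module) : exists v, quotient_pi v = q.
Proof. by exists (repr q); rewrite /quotient_pi reprK. Qed.

Lemma quotient_pi_eq (u v : V) :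
  (quotient_pi u = quotient_pi v) <-> (u - v \in N).
Proof.
rewrite -[_ \in N]/(u - v \in submodule_pred N) Quotient.idealrBE.
by split=> /eqP.
Qed.

Fact quotient_pi_is_zmod_morphism : zmod_morphism quotient_pi.
Proof. by move=> u v; rewrite /quotient_pi raddfB. Qed.
HB.instance Definition _ :=
  GRing.isZmodMorphism.Build V quotient_module quotient_pi
    quotient_pi_is_zmod_morphism.

Definition quotient_scale (a : R) (q : quotient_module) : quotient_module :=
  quotient_pi (a *: repr q).

Lemma quotient_scaleE a v :
  quotient_scale a (quotient_pi v) = quotient_pi (a *: v).
Proof.
apply/quotient_pi_eq; rewrite -scalerBr rpredZ //.
by apply/quotient_pi_eq; rewrite /quotient_pi reprK.
Qed.

Fact quotient_scalerA a b q :
  quotient_scale a (quotient_scale b q) = quotient_scale (a * b) q.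
Proof. by have [v <-] := quotient_piP q; rewrite !quotient_scaleE scalerA. Qed.

Fact quotient_scale1r : left_id 1 quotient_scale.
Proof. by move=> q; have [v <-] := quotient_piP q; rewrite quotient_scaleE scale1r. Qed.

Fact quotient_scalerDr : right_distributive quotient_scale +%R.
Proof.
move=> a q1 q2; have [u <-] := quotient_piP q1; have [v <-] := quotient_piP q2.
by rewrite -raddfD !quotient_scaleE scalerDr raddfD.
Qed.

Fact quotient_scalerDl q : {morph quotient_scale^~ q : a b / a + b}.
Proof.
by move=> a b; have [v <-] := quotient_piP q; rewrite !quotient_scaleE scalerDl raddfD.
Qed.

HB.instance Definition _ := GRing.Zmodule_isLmodule.Build R quotient_module
  quotient_scalerA quotient_scale1r quotient_scalerDr quotient_scalerDl.

Fact quotient_pi_is_scalable : scalable quotient_pi.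
Proof. by move=> a v; rewrite -quotient_scaleE. Qed.
HB.instance Definition _ :=
  GRing.isScalable.Build R V quotient_module *:%R quotient_pi
    quotient_pi_is_scalable.

End QuotientModule.

Arguments quotient_pi {R V} N v.

Notation ideal R := (submodClosed R^o).

Section QuotientRing.
Variables (R : comPzRingType) (I : ideal R).

Definition quotient_ring : Type := quotient_module I.
HB.instance Definition _ := GRing.Lmodule.on quotient_ring.

Definition quotient_proj (x : R) : quotient_ring := quotient_pi I x.

Lemma quotient_projP (q : quotient_ring) : exists x, quotient_proj x = q.
Proof. by have [x <-] := quotient_piP (q : quotient_module I); exists x. Qed.

Lemma quotient_proj_eq (x y : R) :
  (quotient_proj x = quotient_proj y) <-> (x - y \in I).
Proof. exact: (quotient_pi_eq I). Qed.

Fact quotient_proj_is_zmod_morphism : zmod_morphism quotient_proj.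
Proof. by move=> x y; rewrite /quotient_proj raddfB. Qed.
HB.instance Definition _ := GRing.isZmodMorphism.Build R quotient_ring
  quotient_proj quotient_proj_is_zmod_morphism.

Definition quotient_mul (p q : quotient_ring) : quotient_ring :=
  quotient_proj ((repr p : R) * (repr q : R)).

Lemma quotient_mulE x y :
  quotient_mul (quotient_proj x) (quotient_proj y) = quotient_proj (x * y).
Proof.
have rP z : (repr (quotient_proj z) : R) - z \in I.
  by apply/quotient_proj_eq; rewrite /quotient_proj /quotient_pi reprK.
apply/quotient_proj_eq.
rewrite -[X in X - _](subrK (repr (quotient_proj x) * y)) -mulrBr -addrA -mulrBl.
apply: (@rpredD _ (submodule_pred I)).
  exact: (@rpredZ _ _ (submodule_pred I) _ _ (rP y)).
by rewrite mulrC; apply: (@rpredZ _ _ (submodule_pred I) _ _ (rP x)).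
Qed.

Fact quotient_mulA : associative quotient_mul.
Proof.
move=> p q r; have [x <-] := quotient_projP p; have [y <-] := quotient_projP q.
by have [z <-] := quotient_projP r; rewrite !quotient_mulE mulrA.
Qed.

Fact quotient_mulC : commutative quotient_mul.
Proof.
move=> p q; have [x <-] := quotient_projP p; have [y <-] := quotient_projP q.
by rewrite !quotient_mulE mulrC.
Qed.

Fact quotient_mul1 : left_id (quotient_proj 1) quotient_mul.
Proof. by move=> p; have [x <-] := quotient_projP p; rewrite quotient_mulE mul1r. Qed.

Fact quotient_mulDl : left_distributive quotient_mul +%R.
Proof.
move=> p q r; have [x <-] := quotient_projP p; have [y <-] := quotient_projP q.
have [z <-] := quotient_projP r.
by rewrite -raddfD !quotient_mulE mulrDl raddfD.
Qed.

HB.instance Definition _ := GRing.Zmodule_isComPzRing.Build quotient_ring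
  quotient_mulA quotient_mulC quotient_mul1 quotient_mulDl.

Fact quotient_proj_is_monoid_morphism : monoid_morphism quotient_proj.
Proof. by split=> // x y; rewrite -quotient_mulE. Qed.
HB.instance Definition _ := GRing.isMonoidMorphism.Build R quotient_ring
  quotient_proj quotient_proj_is_monoid_morphism.

End QuotientRing.

Arguments quotient_proj {R} I x.

Section HomModule.
Variables (R : comPzRingType) (M N : lmodType R).
Implicit Types f g h : {linear M -> N}.

HB.instance Definition _ := gen_eqMixin {linear M -> N}.
HB.instance Definition _ := gen_choiceMixin {linear M -> N}.

Lemma linear_ext f g : f =1 g -> f = g.
Proof.
case: f g => [f [[f1] [f2]]] [g [[g1] [g2]]] /= /funext fg.
by subst g; rewrite (Prop_irrelevance f1 g1) (Prop_irrelevance f2 g2).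
Qed.

Definition hom0 : {linear M -> N} := (\0 : M -> N).
Definition hom_add f g : {linear M -> N} := (f \+ g).
Definition hom_opp f : {linear M -> N} := (\- f).

Fact hom_addA : associative hom_add.
Proof. by move=> f g h; apply/linear_ext => x /=; rewrite addrA. Qed.
Fact hom_addC : commutative hom_add.
Proof. by move=> f g; apply/linear_ext => x /=; rewrite addrC. Qed.
Fact hom_add0 : left_id hom0 hom_add.
Proof. by move=> f; apply/linear_ext => x /=; rewrite add0r. Qed.
Fact hom_addN : left_inverse hom0 hom_opp hom_add.
Proof. by move=> f; apply/linear_ext => x /=; rewrite addNr. Qed.

HB.instance Definition _ := GRing.isZmodule.Build {linear M -> N}
  hom_addA hom_addC hom_add0 hom_addN.

Section Scale.
Variables (a : R) (f : {linear M -> N}).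
Definition hom_scale_fun (x : M) : N := a *: f x.
Fact hom_scale_is_linear : linear hom_scale_fun.
Proof.
move=> b x y; rewrite /hom_scale_fun linearP scalerDr !scalerA.
by rewrite [a * b]mulrC.
Qed.
HB.instance Definition _ :=
  GRing.isLinear.Build R M N *:%R hom_scale_fun hom_scale_is_linear.
Definition hom_scale : {linear M -> N} := hom_scale_fun.
End Scale.

Fact hom_scaleA a b f : hom_scale a (hom_scale b f) = hom_scale (a * b) f.
Proof. by apply/linear_ext => x /=; rewrite /hom_scale_fun /= scalerA. Qed.
Fact hom_scale1 : left_id 1 hom_scale.
Proof. by move=> f; apply/linear_ext => x /=; rewrite /hom_scale_fun scale1r. Qed.
Fact hom_scaleDr : right_distributive hom_scale +%R.
Proof. by move=> a f g; apply/linear_ext => x /=; rewrite /hom_scale_fun /= scalerDr. Qed.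
Fact hom_scaleDl f : {morph hom_scale^~ f : a b / a + b}.
Proof. by move=> a b; apply/linear_ext => x /=; rewrite /hom_scale_fun scalerDl. Qed.

HB.instance Definition _ := GRing.Zmodule_isLmodule.Build R {linear M -> N}
  hom_scaleA hom_scale1 hom_scaleDr hom_scaleDl.

Lemma hom_addE f g x : (f + g) x = f x + g x. Proof. by []. Qed.
Lemma hom_scaleE a f x : (a *: f) x = a *: f x. Proof. by []. Qed.

End HomModule.

Section IdealGen.
Variables (R : comPzRingType) (G : set R).

Definition ideal_gen : {pred R^o} := fun x =>
  `[< exists2 s : seq (R * R),
        (forall p, p \in s -> G p.2) & x = \sum_(p <- s) p.1 * p.2 >].

Fact ideal_gen_closed : GRing.subsemimod_closed ideal_gen.
Proof.
split; [split|].
- by apply/asboolP; exists [::]; rewrite ?big_nil.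
- move=> x y /asboolP[s sG ->] /asboolP[t tG ->]; apply/asboolP.
  exists (s ++ t); last by rewrite big_cat.
  by move=> p; rewrite mem_cat => /orP[/sG|/tG].
- move=> a x /asboolP[s sG ->]; apply/asboolP.
  exists [seq (a * p.1, p.2) | p <- s]; first by move=> p /mapP[q /sG ? ->].
  rewrite big_map [LHS]mulr_sumr; apply: eq_bigr => p _; exact: mulrA.
Qed.
HB.instance Definition _ :=
  GRing.isSubmodClosed.Build R R^o ideal_gen ideal_gen_closed.

Lemma mem_ideal_gen x : G x -> x \in ideal_gen.
Proof.
move=> Gx; apply/asboolP; exists [:: (1, x)]; last by rewrite big_seq1 mul1r.
by move=> p; rewrite inE => /eqP->.
Qed.

End IdealGen.

Definition noetherian (R : comPzRingType) : Prop :=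
  forall I : ideal R, exists s : seq R, I =i ideal_gen [set x | x \in s].

Definition maximal_ideal (R : comPzRingType) (m : ideal R) : Prop :=
  1 \notin m /\
  forall J : ideal R, {subset m <= J} -> 1 \notin J -> J =i m.

Definition local_ring (R : comPzRingType) : Prop :=
  exists2 m : ideal R, maximal_ideal m &
    forall m' : ideal R, maximal_ideal m' -> m' =i m.

Definition injective_module (R : pzRingType) (E : lmodType R) : Prop :=
  forall (M N : lmodType R) (f : {linear M -> N}) (g : {linear M -> E}),
    injective f -> exists h : {linear N -> E}, forall x, h (f x) = g x.

(* There is an exact sequence 0 -> M -> E 0 -> E 1 -> ... of modules with all  *)
(* the [E i] injective and [E i = 0] for [i > n].                              *)
Definition finite_injective_dimension (R : pzRingType) (M : lmodType R) : Prop :=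
  exists (n : nat) (E : nat -> lmodType R) (e : {linear M -> E 0%N})
         (d : forall i, {linear E i -> E i.+1}),
    [/\ forall i, injective_module (E i),
        injective e,
        forall y, d 0%N y = 0 <-> exists x, e x = y,
        forall i y, d i.+1 y = 0 <-> exists x, d i x = y
      & forall i, (n < i)%N -> forall y : E i, y = 0].

Definition gorenstein_local_ring (R : comPzRingType) : Prop :=
  [/\ noetherian R, local_ring R & finite_injective_dimension R^o].

Definition prime_ideal (R : comPzRingType) (p : ideal R) : Prop :=
  1 \notin p /\ forall x y : R, x * y \in p -> x \in p \/ y \in p.

Definition height_ge (R : comPzRingType) (p : ideal R) (n : nat) : Prop :=
  exists c : nat -> ideal R,
    [/\ forall i, (i <= n)%N -> prime_ideal (c i),
        forall i, (i < n)%N ->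
          {subset c i <= c i.+1} /\ ~ {subset c i.+1 <= c i}
      & c n =i p].

(* The infimum, over the primes containing [I], of their heights is [n].       *)
Definition has_codimension (R : comPzRingType) (I : ideal R) (n : nat) : Prop :=
  (forall p : ideal R, prime_ideal p -> {subset I <= p} -> height_ge p n) /\
  (exists p : ideal R,
     [/\ prime_ideal p, {subset I <= p} & ~ height_ge p n.+1]).

Section SymmetricAlgebra.
Variables (R : comNzRingType) (M : lmodType R).

(* [Sym] is presented by generators and relations: it is the quotient of the   *)
(* polynomial ring over [R] with one variable for each element of [M] by the   *)
(* relations that make [M -> Sym] linear.                                      *)
Definition free_comalg : comNzRingType := {malg R[{cmonom M}]}.
Definition free_comalg_const : {rmorphism R -> free_comalg} := @malgC {cmonom M} R.
Definition free_comalg_var (m : M) : free_comalg := << ucm m >>%R.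

Definition sym_relations : set free_comalg :=
  [set x | (exists m n : M, x = free_comalg_var (m + n)
                                - (free_comalg_var m + free_comalg_var n))
        \/ (exists (a : R) (m : M), x = free_comalg_var (a *: m)
                                - free_comalg_const a * free_comalg_var m)].

Definition Sym : comPzRingType := quotient_ring (ideal_gen sym_relations).
Definition Sym_const : {rmorphism R -> Sym} :=
  (quotient_proj (ideal_gen sym_relations) \o free_comalg_const).
Definition Sym_var (m : M) : Sym :=
  quotient_proj (ideal_gen sym_relations) (free_comalg_var m).

Lemma Sym_varD (m n : M) : Sym_var (m + n) = Sym_var m + Sym_var n.
Proof.
rewrite /Sym_var -raddfD; apply/quotient_proj_eq/mem_ideal_gen; left.
by exists m, n.
Qed.

Lemma Sym_varZ (a : R) (m : M) : Sym_var (a *: m) = Sym_const a * Sym_var m.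
Proof.
rewrite /Sym_var /Sym_const /= -rmorphM; apply/quotient_proj_eq/mem_ideal_gen.
by right; exists a, m.
Qed.

End SymmetricAlgebra.

Arguments Sym_const {R} M.

Definition regular_on (R : pzRingType) (N : lmodType R) (t : R) : Prop :=
  forall n : N, n <> 0 -> t *: n <> 0.

Fact regular_onM (R : pzRingType) (N : lmodType R) t u :
  regular_on N t -> regular_on N u -> regular_on N (t * u).
Proof. by move=> tN uN n n0; rewrite -scalerA; apply: tN; apply: uN. Qed.

Definition torsion (R A : comPzRingType) (h : {rmorphism R -> A}) (T : set R) :
  {pred A^o} := fun u => `[< exists2 t, T t & h t * u = 0 >].

Fact torsion_closed (R A : comPzRingType) (h : {rmorphism R -> A}) (T : set R) :
  T 1 -> (forall t t', T t -> T t' -> T (t * t')) ->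
  GRing.subsemimod_closed (torsion h T).
Proof.
move=> T1 TM; split; [split|].
- by apply/asboolP; exists 1; rewrite ?mulr0.
- move=> u v /asboolP[t Tt tu] /asboolP[t' Tt' t'v]; apply/asboolP.
  exists (t * t'); first exact: TM.
  rewrite rmorphM mulrDr -[_ * _ * v]mulrA t'v mulr0 addr0.
  by rewrite [X in X * u]mulrC -mulrA tu mulr0.
- move=> a u /asboolP[t Tt tu]; apply/asboolP; exists t => //.
  by rewrite [a *: u]/(a * u) mulrCA tu mulr0.
Qed.

Section Unprojection.
Variables (O : comNzRingType) (I : ideal O).

Local Notation Hom := {linear submodule I -> O^o}.

Definition mul_hom_fun (a : O) (x : submodule I) : O^o := a * val x.
Fact mul_hom_is_linear a : linear (mul_hom_fun a).
Proof.
by move=> b x y; rewrite /mul_hom_fun !linearP mulrDr mulrCA.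
Qed.
HB.instance Definition _ a := GRing.isLinear.Build O (submodule I) O^o *:%R
  (mul_hom_fun a) (mul_hom_is_linear a).
Definition mul_hom (a : O) : Hom := mul_hom_fun a.

Definition mul_homs : {pred Hom} := fun phi => `[< exists a, phi = mul_hom a >].

Fact mul_homs_closed : GRing.subsemimod_closed mul_homs.
Proof.
split; [split|].
- apply/asboolP; exists 0; apply/linear_ext => x.
  by rewrite /mul_hom /= /mul_hom_fun mul0r.
- move=> f g /asboolP[a ->] /asboolP[b ->]; apply/asboolP; exists (a + b).
  by apply/linear_ext => x; rewrite hom_addE /mul_hom /= /mul_hom_fun mulrDl.
- move=> a f /asboolP[b ->]; apply/asboolP; exists (a * b).
  by apply/linear_ext => x; rewrite hom_scaleE /mul_hom /= /mul_hom_fun -mulrA.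
Qed.
HB.instance Definition _ :=
  GRing.isSubmodClosed.Build O Hom mul_homs mul_homs_closed.

Definition ideal_incl : Hom := (val : submodule I -> O^o).

Definition unproj_ring1 : comPzRingType :=
  quotient_ring (ideal_gen [set x : Sym Hom | x = Sym_var ideal_incl - 1]).
Definition unproj_ring1_proj : {rmorphism Sym Hom -> unproj_ring1} :=
  quotient_proj (ideal_gen [set x : Sym Hom | x = Sym_var ideal_incl - 1]).
Definition unproj_ring1_const : {rmorphism O -> unproj_ring1} :=
  (unproj_ring1_proj \o Sym_const Hom).

Definition biregular : set O :=
  [set t | regular_on O^o t /\ regular_on (quotient_ring I) t].

Definition unpr_torsion : {pred unproj_ring1^o} :=
  torsion unproj_ring1_const biregular.

Fact unpr_torsion_closed : GRing.subsemimod_closed unpr_torsion.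
Proof.
apply: torsion_closed; first by split=> n; rewrite scale1r.
by move=> t t' [tO tD] [t'O t'D]; split; apply: regular_onM.
Qed.
HB.instance Definition _ := GRing.isSubmodClosed.Build unproj_ring1
  unproj_ring1^o unpr_torsion unpr_torsion_closed.

Definition unpr : comPzRingType := quotient_ring unpr_torsion.
Definition unpr_proj : {rmorphism unproj_ring1 -> unpr} :=
  quotient_proj unpr_torsion.
Definition unpr_const : {rmorphism O -> unpr} := (unpr_proj \o unproj_ring1_const).
Definition unpr_class (phi : Hom) : unpr :=
  unpr_proj (unproj_ring1_proj (Sym_var phi)).

End Unprojection.

Arguments mul_homs {O} I phi.

(* [horner_morph] requires a nonzero target ring, hence this variant.          *)
Section PolyEval.
Variables (R : comNzRingType) (A : comPzRingType).
Variables (h : {rmorphism R -> A}) (u : A).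

Definition poly_eval (p : {poly R}) : A := \sum_(i < size p) h p`_i * u ^+ i.

Lemma poly_eval_wide n (p : {poly R}) : (size p <= n)%N ->
  poly_eval p = \sum_(i < n) h p`_i * u ^+ i.
Proof.
move=> le_pn; rewrite /poly_eval (big_ord_widen n (fun i => h p`_i * u ^+ i) le_pn).
rewrite big_mkcond /=; apply: eq_bigr => i _; case: ltnP => // le_pi.
by rewrite nth_default // rmorph0 mul0r.
Qed.

Fact poly_eval_is_zmod_morphism : zmod_morphism poly_eval.
Proof.
move=> p q; pose n := maxn (size p) (size q).
rewrite (@poly_eval_wide n (p - q)); last first.
  by rewrite (leq_trans (size_polyD _ _)) // size_polyN.
rewrite (@poly_eval_wide n p) ?leq_maxl // (@poly_eval_wide n q) ?leq_maxr //.
by rewrite -sumrB; apply: eq_bigr => i _; rewrite coefB rmorphB mulrBl.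
Qed.
HB.instance Definition _ := GRing.isZmodMorphism.Build {poly R} A poly_eval
  poly_eval_is_zmod_morphism.

Lemma poly_evalC c : poly_eval c%:P = h c.
Proof.
rewrite (@poly_eval_wide 1) ?size_polyC_leq1 //.
by rewrite big_ord_recl big_ord0 coefC expr0 mulr1 addr0.
Qed.

Lemma poly_evalMX p : poly_eval (p * 'X) = poly_eval p * u.
Proof.
rewrite (@poly_eval_wide (size p).+1); last first.
  by rewrite (leq_trans (size_polyMleq _ _)) // size_polyX addn2.
rewrite big_ord_recl coefMX rmorph0 mul0r add0r /poly_eval mulr_suml.
by apply: eq_bigr => i _; rewrite coefMX exprSr mulrA.
Qed.

Lemma poly_evalX : poly_eval 'X = u.
Proof. by rewrite -[X in poly_eval X]mul1r poly_evalMX poly_evalC rmorph1 mul1r. Qed.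

Fact poly_eval_is_monoid_morphism : monoid_morphism poly_eval.
Proof.
have evalCM c p : poly_eval (c%:P * p) = h c * poly_eval p.
  rewrite (@poly_eval_wide (size p)); last first.
    by rewrite mul_polyC size_scale_leq.
  by rewrite mulr_sumr; apply: eq_bigr => i _; rewrite coefCM rmorphM mulrA.
split; first by rewrite poly_evalC rmorph1.
move=> p q; elim/poly_ind: p => [|p c IH]; first by rewrite !(mul0r, raddf0).
have -> : (p * 'X + c%:P) * q = p * q * 'X + c%:P * q.
  by rewrite mulrDl [p * 'X * q]mulrAC.
rewrite !raddfD /= !poly_evalMX IH evalCM poly_evalC mulrDl.
by rewrite [_ * u * _]mulrAC.
Qed.
HB.instance Definition _ := GRing.isMonoidMorphism.Build {poly R} A poly_eval
  poly_eval_is_monoid_morphism.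

End PolyEval.

(* [lalgType] requires nonzero rings, so algebras are given by their structure *)
(* morphisms.                                                                  *)
Definition algebra_iso (R A B : pzRingType)
    (a : {rmorphism R -> A}) (b : {rmorphism R -> B}) : Prop :=
  exists2 phi : {rmorphism A -> B}, bijective phi & forall c, phi (a c) = b c.

Section KustinMiller.
Variables (O : comNzRingType) (I : ideal O).
Variables (s : {linear submodule I -> O^o}) (r : nat) (f : 'I_r -> submodule I).

Definition psi2 : {rmorphism {poly O} -> unpr I} :=
  poly_eval (unpr_const I) (unpr_class s).

Definition KM_ideal : ideal {poly O} :=
  ideal_gen [set p | exists j : 'I_r,
    p = 'X * (val (f j) : O)%:P - (s (f j) : O)%:P].

Definition KM_ring : comPzRingType := quotient_ring KM_ideal.

Definition KM_const : {rmorphism O -> KM_ring} := (quotient_proj KM_ideal \o polyC).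

End KustinMiller.

(* Main.v *)
(* Let A be the local Gorenstein ring, I the ideal, D = A/I, and                *)
(* Ext^i(A/a) = Ext^i_A(A/a, A). Every h in Hom(I, A) has the form c s + a, so  *)
(* R_1 is generated by S = [s], with relations b S = a for b s = a on I. The    *)
(* relations [S f_j - g_j] suffice as soon as (1) only 0 is killed by I and (2) *)
(* b s = a on I forces b in I. The leading coefficients of the elements of      *)
(* positive degree of the ideal (S f_j - g_j) lie in I, and its only constant   *)
(* is 0, so that elements regular on both A and A/I are regular on the          *)
(* quotient: J = 0.                                                             *)
(*   (1) and (2) follow from finite injective dimension. All modules are cyclic *)
(* and Ext^i(A/a) is computed as the cohomology of the complex of elements of   *)
(* an injective resolution killed by a. If b is generated by a regular sequence *)
(* of length l, then Ext^i(A/b) = 0 for i <> l and Ext^l(A/b) = A/b. With       *)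
(* Nakayama's lemma this yields unmixedness: a prime (b : w) is minimal over b. *)
(* For b = 0 this gives (1). Applied to a maximal regular sequence of D, it     *)
(* makes m the only prime over I + (y_1, ..., y_d); as adjoining an element     *)
(* raises the grade by at most one and I has grade 1, A has depth at most d + 1 *)
(* and so Ext^i(A/I) = 0 for i > 1. If (2) fails for b, where p = (I : b) may   *)
(* be taken prime, then multiplication by b kills Ext^1(A/I), so Ext^1(A/p) = 0 *)
(* at p; therefore all Ext^1 vanish at p, and so do all Ext^0, since            *)
(* Ext^0(A/p) = 0 by (1). This contradicts Ext^0(A) = A.                        *)

Require Import Defs.
From HB Require Import structures.
From mathcomp Require Import all_boot all_algebra.
From mathcomp Require Import boolp classical_sets.
From mathcomp Require Import ring.
From mathcomp Require Import finmap monalg.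

Set Implicit Arguments.
Unset Strict Implicit.
Unset Printing Implicit Defensive.

Import GRing.Theory.

Local Open Scope classical_set_scope.
Local Open Scope ring_scope.

(** * Ideals as sets *)

(** Ext^i(A/a) stands for Ext^i(A/a, A). Every homomorphism I -> O is some c s + a, so O[S] maps
    onto R_1 by [unproj_eval]; since f_j s is multiplication by g_j, this map kills S f_j - g_j.
    Sending c s + a to c S + a inverts it modulo (S f_j - g_j), as the choice of c and a does not
    matter there ([lin_poly_KM]). This uses the two facts of [gorenstein_unprojection]: only 0 is
    annihilated by I, and b s = a on I forces b in I. So R_1 = O[S]/(S f_j - g_j)
    ([unproj_eval_eq0]), on which T acts injectively ([KM_torsion_free]); hence J = 0.

    Both facts come from finite injective resolutions. [ext_regular_chain] computes Ext modulo a
    regular sequence, and [ext_nakayama] lets vanishing descend in degree. This gives unmixedness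
    ([regular_chain_unmixed]), hence the first fact, and, through parameters of D, Ext^i(A/I) = 0
    for i > 1 ([codim_ext_van]). A failure of the second fact would then make Ext^0(A) = A vanish at
    a prime ([hom_multiplier_mem]). *)

Section IdealSets.
Variable A : comPzRingType.
Implicit Types (a b p q : set A) (u v w x y : A).

Definition is_ideal a : Prop :=
  [/\ a 0, forall x y, a x -> a y -> a (x + y) & forall c x, a x -> a (c * x)].

Definition colon a u : set A := [set c | a (c * u)].
Definition adjoin a u : set A := [set c | exists r, a (c - r * u)].

Definition is_prime p : Prop :=
  [/\ is_ideal p, ~ p 1 & forall x y, p (x * y) -> p x \/ p y].

(** Stated for any family of subsets, as it serves for ideals and, in [ext_noeth], for submodules of
    Ext. *)
Definition max_condition (V : Type) (C : set (set V)) : Prop :=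
  forall F : set (set V), F `<=` C -> F !=set0 ->
  exists2 S, F S & forall T, F T -> S `<=` T -> T `<=` S.

Lemma is_idealN a x : is_ideal a -> a x -> a (- x).
Proof. by move=> [_ _ aM] ax; rewrite -mulN1r; apply: aM. Qed.

Lemma is_idealB a x y : is_ideal a -> a x -> a y -> a (x - y).
Proof. by move=> ia ax ay; have [_ aD _] := ia; apply: aD => //; apply: is_idealN. Qed.

Lemma is_idealMr a x c : is_ideal a -> a x -> a (x * c).
Proof. by move=> [_ _ aM] ax; rewrite mulrC; apply: aM. Qed.

Lemma is_ideal_addl a x y : is_ideal a -> a y -> a (x + y) -> a x.
Proof. by move=> ia ay axy; rewrite -(addrK y x); apply: is_idealB. Qed.

Lemma zero_ideal : is_ideal [set 0].
Proof.
by split=> [|x y -> ->|c x ->] //=; rewrite ?addr0 ?mulr0.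
Qed.

Lemma colon_ideal a u : is_ideal a -> is_ideal (colon a u).
Proof.
move=> [a0 aD aM]; split=> [|x y|c x]; rewrite /colon /=.
- by rewrite mul0r.
- by move=> ax ay; rewrite mulrDl; apply: aD.
- by move=> ax; rewrite -mulrA; apply: aM.
Qed.

Lemma adjoin_ideal a u : is_ideal a -> is_ideal (adjoin a u).
Proof.
move=> [a0 aD aM]; split=> [|x y [r ar] [s as_]|c x [r ar]].
- by exists 0; rewrite mul0r subr0.
- by exists (r + s); rewrite mulrDl opprD addrACA; apply: aD.
- by exists (c * r); rewrite -mulrA -mulrBr; apply: aM.
Qed.

Lemma sub_colon a u : is_ideal a -> a `<=` colon a u.
Proof. by move=> ia x ax; apply: is_idealMr. Qed.

Lemma sub_adjoin a u : a `<=` adjoin a u.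
Proof. by move=> x ax; exists 0; rewrite mul0r subr0. Qed.

Lemma mem_adjoin a u : is_ideal a -> adjoin a u u.
Proof. by move=> [a0 _ _]; exists 1; rewrite mul1r subrr. Qed.

Lemma adjoin_min a b u : is_ideal b -> a `<=` b -> b u -> adjoin a u `<=` b.
Proof.
move=> ib ab bu x [r /ab bx]; have [_ bD bM] := ib.
by rewrite -(subrK (r * u) x); apply: bD => //; apply: bM.
Qed.

Lemma colon_prime p u : is_prime p -> ~ p u -> colon p u = p.
Proof.
move=> [ip _ pP] pu; apply/seteqP; split; last exact: sub_colon.
by move=> x /pP[].
Qed.

Lemma prime_mul p x y : is_prime p -> ~ p x -> ~ p y -> ~ p (x * y).
Proof. by move=> [_ _ pP] px py /pP[]. Qed.

(* Among the proper colon ideals [(b : x)] with [x] in a multiplicatively      *)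
(* stable set [X], the maximal ones are prime.                                 *)
Lemma maximal_colon_prime b (X : set A) w : is_ideal b ->
  (forall c x, X x -> X (c * x)) -> X w -> ~ b w ->
  (forall x, X x -> ~ b x -> colon b w `<=` colon b x -> colon b x `<=` colon b w) ->
  is_prime (colon b w).
Proof.
move=> ib XM Xw bw wmax; split; first exact: colon_ideal.
  by rewrite /colon /= mul1r.
move=> x y bxyw; have [bxw|bxw] := pselect (colon b w x); [by left|right].
apply: (wmax (x * w)) => //; first exact: XM.
  by move=> c bcw; rewrite /colon /= mulrCA; have [_ _ bM] := ib; apply: bM.
by rewrite /colon /= mulrA [y * x]mulrC.
Qed.

Section MaxCondition.
Hypothesis acc : max_condition is_ideal.

Lemma exists_maximal_colon b (X : set A) : is_ideal b ->
  (exists2 x, X x & ~ b x) ->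
  exists w, [/\ X w, ~ b w &
    forall x, X x -> ~ b x -> colon b w `<=` colon b x -> colon b x `<=` colon b w].
Proof.
move=> ib [x Xx bx].
have [||S0 FS0 S0max] := acc (F := [set a | exists2 x, X x /\ ~ b x & a = colon b x]).
- by move=> _ [y _ ->]; apply: colon_ideal.
- by exists (colon b x), x.
case: FS0 S0max => w [Xw bw] -> wmax; exists w; split=> // y Xy byn sub.
by apply: wmax => //; exists y.
Qed.

Lemma colon_prime_exists b (X : set A) : is_ideal b ->
  (forall c x, X x -> X (c * x)) -> (exists2 x, X x & ~ b x) ->
  exists2 w, X w & is_prime (colon b w).
Proof.
move=> ib XM /(exists_maximal_colon ib)[w [Xw bw wmax]].
by exists w => //; apply: maximal_colon_prime wmax.
Qed.

(** Take (b : w) maximal among the colon ideals inside [p], and x y in it. If (b : x w) is inside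
    [p], maximality puts y in (b : w). Otherwise some z outside [p] lies in (b : x w); then x lies
    in (b : z w), which equals (b : w). *)
Lemma colon_prime_below b p : is_ideal b -> is_prime p -> b `<=` p ->
  exists w, is_prime (colon b w) /\ colon b w `<=` p.
Proof.
move=> ib pp bp; have [ip p1 pP] := pp.
have [||S0 FS0 S0max] := acc (F := [set a | exists2 x, colon b x `<=` p & a = colon b x]).
- by move=> _ [y _ ->]; apply: colon_ideal.
- by exists (colon b 1), 1 => // x; rewrite /colon /= mulr1; apply: bp.
case: FS0 S0max => w wp -> wmax; exists w; split=> //; split; first exact: colon_ideal.
  by move=> /wp.
move=> x y bxyw; have [bxw|bxw] := pselect (colon b w x); [by left|right].
have [xwp|/existsNP[z /not_implyP[bz pz]]] := pselect (colon b (x * w) `<=` p).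
  apply: (wmax (colon b (x * w))); first by exists (x * w).
    by move=> c bcw; rewrite /colon /= mulrCA; have [_ _ bM] := ib; apply: bM.
  by rewrite /colon /= mulrA [y * x]mulrC.
case: bxw; apply: (wmax (colon b (z * w))).
- exists (z * w) => // c; rewrite /colon /= mulrA => /wp/pP[//|/pz].
  by [].
- by move=> c bcw; rewrite /colon /= mulrCA; have [_ _ bM] := ib; apply: bM.
- by rewrite /colon /= mulrCA.
Qed.

(** Replaces induction on generators: an ideal maximal among those between [b] and [a] that satisfy
    [Q] must be [a]. *)
Lemma ideal_chain_ind (Q : set A -> Prop) b a : is_ideal b -> is_ideal a ->
  b `<=` a -> Q b ->
  (forall c u, is_ideal c -> b `<=` c -> c `<=` a -> a u -> Q c -> Q (adjoin c u)) ->
  Q a.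
Proof.
move=> ib ia ba Qb Qadj.
have [||S0 FS0 S0max] := acc (F := [set c | [/\ is_ideal c, b `<=` c, c `<=` a & Q c]]).
- by move=> c [].
- by exists b; split.
case: FS0 S0max => ic bc ca Qc cmax.
suff -> : a = S0 by [].
apply/seteqP; split=> // u au; apply: (cmax (adjoin S0 u)); last exact: mem_adjoin.
  split; [exact: adjoin_ideal| |exact: adjoin_min|exact: Qadj].
  by apply: subset_trans bc _; apply: sub_adjoin.
exact: sub_adjoin.
Qed.


Lemma prime_avoids_meet (T : eqType) (c : T -> set A) (s : seq T) p m :
  is_prime p -> is_ideal m -> (forall k, k \in s -> is_ideal (c k)) ->
  ~ (m `<=` p) -> (forall k, k \in s -> ~ (c k `<=` p)) ->
  exists z, [/\ m z, forall k, k \in s -> c k z & ~ p z].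
Proof.
move=> pp im ic /existsNP[x /not_implyP[mx px]].
elim: s ic => [|k s IH] ic cp; first by exists x.
have [||z [mz cz pz]] := IH.
- by move=> j us; apply: ic; rewrite inE us orbT.
- by move=> j us; apply: cp; rewrite inE us orbT.
have /existsNP[y /not_implyP[cy py]] := cp k (mem_head _ _).
exists (y * z); split; last exact: prime_mul.
  by case: im => _ _; apply.
move=> j; rewrite inE => /predU1P[->|us].
  by apply: is_idealMr => //; apply/ic/mem_head.
have [_ _ cM] : is_ideal (c j) by apply: ic; rewrite inE us orbT.
by apply/cM/cz.
Qed.

(* The proof is prime avoidance. Only finitely many colon ideals [(b : w)] are *)
(* maximal: the [w]'s generate, modulo [b], an ideal generated by finitely     *)
(* many of them.                                                               *)
Lemma regular_or_killed b m : is_ideal b -> is_ideal m ->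
  (exists2 x, m x & forall c, b (c * x) -> b c) \/
  (exists2 w, ~ b w & m `<=` colon b w).
Proof.
move=> ib im.
have [|nk] := pselect (exists2 w, ~ b w & m `<=` colon b w); [by right|left].
have [m0 mD mM] := im.
pose maxc w := ~ b w /\
  forall x, ~ b x -> colon b w `<=` colon b x -> colon b x `<=` colon b w.
have maxcP w : maxc w -> is_prime (colon b w).
  by move=> [bw wm]; apply: (@maximal_colon_prime _ setT) => // x _; apply: wm.
have maxc_m w : maxc w -> ~ (m `<=` colon b w).
  by case=> bw _ mw; apply: nk; exists w.
have maxc_sub v w : maxc v -> maxc w -> colon b v `<=` colon b w ->
    colon b w `<=` colon b v by move=> [_ vm] [bw _]; apply: vm.
have avoid (s : seq A) : (forall w, w \in s -> maxc w) ->
    exists2 t, m t & forall w, w \in s -> ~ colon b w t.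
  elim: s => [_|w s IH sm]; first by exists 0.
  have mw : maxc w by apply: sm; rewrite mem_head.
  have smx v : v \in s -> maxc v by move=> vs; apply: sm; rewrite inE vs orbT.
  have [t mt ts] := IH smx.
  have [tw|tw] := pselect (colon b w t); last first.
    by exists t => // v; rewrite inE => /predU1P[->|/ts].
  have [|||z [mz zs zw]] := prime_avoids_meet (c := colon b) (s := s) (maxcP w mw) im.
  - by move=> v _; apply: colon_ideal.
  - exact: maxc_m.
  - by move=> v vs vw; apply: (ts v vs); apply: (maxc_sub v w) => //; apply: smx.
  exists (t + z); first exact: mD.
  move=> v; rewrite inE => /predU1P[->|vs] vtz.
    apply: zw; apply: (is_ideal_addl (colon_ideal w ib) tw).
    by rewrite addrC.
  by apply: (ts v vs); apply: (is_ideal_addl (colon_ideal v ib) (zs v vs) vtz).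
pose hull s : set A := foldr (fun w c => adjoin c w) b s.
have ihull s : is_ideal (hull s) by elim: s => //= w s; apply: adjoin_ideal.
have [||_ [s sm ->] hmax] :=
  acc (F := [set c | exists2 s, (forall w, w \in s -> maxc w) & c = hull s]).
- by move=> _ [s _ ->].
- by exists b, [::].
have [t mt ts] := avoid s sm; exists t => // c bct; apply: contrapT => bc.
have [|w [bwt bw wm]] := exists_maximal_colon (X := [set x | b (t * x)]) ib.
  by exists c => //=; rewrite mulrC.
(* A colon ideal containing (b : w) also contains [t], so maximality among the [x] with [t * x] in
   [b] is maximality among all. *)
have mw : maxc w.
  by split=> // x bx wx; apply: wm => //; apply: wx.
have hw : hull s w.
  apply: (hmax (hull (w :: s))); last exact: mem_adjoin.
    by exists (w :: s) => // v; rewrite inE => /predU1P[->|/sm].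
  exact: sub_adjoin.
have [|||z [mz zs zw]] := prime_avoids_meet (c := colon b) (s := s) (maxcP w mw) im.
- by move=> v _; apply: colon_ideal.
- exact: maxc_m.
- by move=> v vs vw; apply: (ts v vs); apply: (maxc_sub v w) => //; apply: sm.
(* As [z] lies in (b : v) for each [v] in [s], it multiplies all of [hull s] into [b], in particular
   [w]. *)
apply: zw; elim: s w zs hw {ihull hmax sm ts mw wm bw bwt} => [|v s IH] w zs /=.
  by move=> bw; rewrite /colon /=; case: ib => _ _; apply.
move=> [r /IH hr]; have {}hr : colon b (w - r * v) z.
  by apply: hr => u us; apply: zs; rewrite inE us orbT.
rewrite /colon /= -(subrK (r * v) w) mulrDr; have [_ bD bM] := ib.
by apply: bD => //; rewrite mulrCA; apply/bM/zs/mem_head.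
Qed.

End MaxCondition.
End IdealSets.

(** * Ext of cyclic modules *)

(* Of the injectivity of the modules, only its consequence [res_lift] for      *)
(* multiplication [A/(a : u) -> A/a] by [u] is needed.                         *)
Record resolution (A : comPzRingType) := Resolution {
  res_mod :> nat -> lmodType A;
  res_aug : {linear A^o -> res_mod 0%N};
  res_diff : forall i, {linear res_mod i -> res_mod i.+1};
  res_len : nat;
  res_aug_inj : injective res_aug;
  res_exact0 : forall y, res_diff 0%N y = 0 <-> exists x, res_aug x = y;
  res_exact : forall i y, res_diff i.+1 y = 0 <-> exists x, res_diff i x = y;
  res_bound : forall i, (res_len < i)%N -> forall y : res_mod i, y = 0;
  res_lift : forall i (a : set A) u (z : res_mod i), is_ideal a ->
    (forall c, a (c * u) -> c *: z = 0) ->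
    exists2 w, forall c, a c -> c *: w = 0 & u *: w = z }.

Section Ext.
Variables (A : comPzRingType) (E : resolution A).
Implicit Types (a b c p q S : set A) (r u v x y t : A) (i j : nat).

Local Notation d := (@res_diff A E _).
Local Notation e := (@res_aug A E).

(** This is Hom(A/a, E i), a map being given by the image of 1. *)
Definition killed i a : set (E i) := [set z | forall r, a r -> r *: z = 0].
Definition cocycle i a : set (E i) := [set z | killed a z /\ d z = 0].
Definition cobound i a : set (E i) :=
  match i return set (E i) with
  | 0%N => [set 0]
  | j.+1 => [set z | exists2 w : E j, killed a w & d w = z]
  end.
Arguments killed i a : clear implicits.
Arguments cocycle i a : clear implicits.
Arguments cobound i a : clear implicits.

(* [Ext^i(A/a, A)] is [cocycle i a] modulo [cobound i a], and [ext_van S i a]  *)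
(* says that its localization at [S] is zero.                                  *)
Definition ext_van S i a : Prop :=
  forall z, cocycle i a z -> exists2 r, S r & cobound i a (r *: z).

Definition mul_set S : Prop := S 1 /\ forall x y, S x -> S y -> S (x * y).

Lemma res_diffdiff i (z : E i) : d (d z) = 0.
Proof. by apply/res_exact; exists z. Qed.

Lemma killedS i a b : a `<=` b -> killed i b `<=` killed i a.
Proof. by move=> ab z bz r /ab/bz. Qed.

Lemma killedD i a z w : killed i a z -> killed i a w -> killed i a (z + w).
Proof. by move=> az aw r ar; rewrite scalerDr az // aw // addr0. Qed.

Lemma killedZ i a r z : killed i a z -> killed i a (r *: z).
Proof. by move=> az s as_; rewrite scalerA mulrC -scalerA az // scaler0. Qed.

Lemma killedB i a z w : killed i a z -> killed i a w -> killed i a (z - w).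
Proof. by move=> az aw; rewrite -scaleN1r; apply/killedD/killedZ. Qed.

Lemma killed0 i a : killed i a 0.
Proof. by move=> r _; rewrite scaler0. Qed.

Lemma killed_diff i a z : killed i a z -> killed i.+1 a (d z).
Proof. by move=> az r ar; rewrite -linearZ az // linear0. Qed.

Lemma killed_adjoin i a u z : is_ideal a ->
  killed i (adjoin a u) z <-> killed i a z /\ u *: z = 0.
Proof.
move=> ia; split=> [auz|[az uz] x [r ax]].
  split; first exact: killedS (@sub_adjoin _ a u) _ auz.
  exact/auz/mem_adjoin.
by rewrite -(subrK (r * u) x) scalerDl az // -scalerA uz scaler0 addr0.
Qed.

Lemma killed_colon i a u z : killed i a z -> killed i (colon a u) (u *: z).
Proof. by move=> az r ar; rewrite scalerA az. Qed.

Lemma killed_lift i a u z : is_ideal a -> killed i (colon a u) z ->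
  exists2 w, killed i a w & u *: w = z.
Proof. by move=> ia kz; apply: res_lift. Qed.

Lemma cocycleS i a b : a `<=` b -> cocycle i b `<=` cocycle i a.
Proof. by move=> ab z [bz dz]; split=> //; apply: killedS bz. Qed.

Lemma cocycleD i a z w : cocycle i a z -> cocycle i a w -> cocycle i a (z + w).
Proof. by move=> [az dz] [aw dw]; split; [exact: killedD|rewrite linearD dz dw addr0]. Qed.

Lemma cocycleZ i a r z : cocycle i a z -> cocycle i a (r *: z).
Proof. by move=> [az dz]; split; [exact: killedZ|rewrite linearZ /= dz scaler0]. Qed.

Lemma cocycleB i a z w : cocycle i a z -> cocycle i a w -> cocycle i a (z - w).
Proof. by move=> az aw; rewrite -scaleN1r; apply/cocycleD/cocycleZ. Qed.

Lemma cocycle_adjoin i a u z : is_ideal a ->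
  cocycle i (adjoin a u) z <-> cocycle i a z /\ u *: z = 0.
Proof.
by move=> ia; split=> [[/killed_adjoin[]]|[[az dz] uz]] //; split=> //; apply/killed_adjoin.
Qed.

Lemma cocycle_colon i a u z : cocycle i a z -> cocycle i (colon a u) (u *: z).
Proof. by move=> [az dz]; split; [exact: killed_colon|rewrite linearZ /= dz scaler0]. Qed.

Lemma cobound_cocycle i a : cobound i a `<=` cocycle i a.
Proof.
case: i => [z ->|i z [w aw <-]] /=; split; rewrite ?linear0 ?res_diffdiff //.
  exact: killed0.
exact: killed_diff.
Qed.

Lemma coboundS i a b : a `<=` b -> cobound i b `<=` cobound i a.
Proof. by move=> ab; case: i => [//|i] z [w bw <-] /=; exists w => //; apply: killedS bw. Qed.

Lemma cobound0 i a : cobound i a 0.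
Proof. by case: i => [//|i] /=; exists 0; rewrite ?linear0 //; apply: killed0. Qed.

Lemma coboundD i a z w : cobound i a z -> cobound i a w -> cobound i a (z + w).
Proof.
case: i z w => [z w -> ->|i z w [z' az <-] [w' aw <-]] /=; first by rewrite addr0.
by exists (z' + w'); [exact: killedD|rewrite linearD].
Qed.

Lemma coboundZ i a r z : cobound i a z -> cobound i a (r *: z).
Proof.
case: i z => [z ->|i z [z' az <-]] /=; first by rewrite scaler0.
by exists (r *: z'); [exact: killedZ|rewrite linearZ].
Qed.

Lemma cobound_colon i a u z : cobound i a z -> cobound i (colon a u) (u *: z).
Proof.
case: i z => [z ->|i z [w aw <-]] /=; first by rewrite scaler0.
by exists (u *: w); [exact: killed_colon|rewrite linearZ].
Qed.

Lemma cobound_lift i a u z : is_ideal a -> cobound i (colon a u) z ->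
  exists2 w, cobound i a w & u *: w = z.
Proof.
move=> ia; case: i z => [z ->|i z [w aw <-]] /=; first by exists 0; rewrite ?scaler0.
have [w' aw' <-] := killed_lift ia aw.
by exists (d w'); [exists w'|rewrite linearZ].
Qed.

Lemma cobound_last i a z : (res_len E < i)%N -> cobound i a z.
Proof. by move=> /res_bound z0; rewrite (z0 z); apply: cobound0. Qed.

Lemma cocycle_aug a z : cocycle 0 a z <-> exists2 x, e x = z & forall r, a r -> r * x = 0.
Proof.
split=> [[az /res_exact0[x xz]]|[x <- ax]].
  exists x => // r ar; apply: (@res_aug_inj A E).
  by rewrite linear0 -(az r ar) -xz -linearZ.
split; last by apply/res_exact0; exists x.
by move=> r ar; rewrite -linearZ /= [r *: _](ax r ar) linear0.
Qed.

Lemma ext_van_last S i a : S 1 -> (res_len E < i)%N -> ext_van S i a.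
Proof. by move=> S1 li z _; exists 1 => //; apply: cobound_last. Qed.

Lemma ext_vanS S S' i a : S `<=` S' -> ext_van S i a -> ext_van S' i a.
Proof. by move=> SS' va z /va[r /SS' Sr rz]; exists r. Qed.

Lemma ext_van_killed S i a r : S r -> a r -> ext_van S i a.
Proof. by move=> Sr ar z [az _]; exists r; rewrite ?az //; apply: cobound0. Qed.

(** * The long exact sequence of 0 -> A/(a : u) -> A/a -> A/(a, u) -> 0, localized *)

Section LongExactSequence.
Variables (S : set A) (a : set A) (u : A).
Hypotheses (Smul : mul_set S) (ia : is_ideal a).

Lemma ext_van_mid i : ext_van S i (adjoin a u) -> ext_van S i (colon a u) ->
  ext_van S i a.
Proof.
move=> v2 v1 z az; have [_ SM] := Smul.
have [r Sr] := v1 _ (cocycle_colon u az); move=> /(cobound_lift ia)[w aw uw].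
have [|s Ss sz] := v2 (r *: z - w).
  apply/cocycle_adjoin => //; split.
    exact/cocycleB/cobound_cocycle/aw/cocycleZ.
  by rewrite scalerBr uw scalerA mulrC -scalerA subrr.
exists (s * r); first exact: SM.
rewrite -scalerA -(subrK w (r *: z)) scalerDr; apply: coboundD.
  exact: coboundS (@sub_adjoin _ a u) _ sz.
exact: coboundZ.
Qed.

Lemma cobound_adjoin i z : ext_van S i (colon a u) ->
  cocycle i.+1 (adjoin a u) z -> cobound i.+1 a z ->
  exists2 r, S r & cobound i.+1 (adjoin a u) (r *: z).
Proof.
move=> v1 /cocycle_adjoin[//|az uz] [w aw dw].
have [|r Sr] := v1 (u *: w).
  by split; [exact: killed_colon|rewrite linearZ /= dw].
move=> /(cobound_lift ia)[w' aw' uw']; have [kw' dw'] := cobound_cocycle aw'.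
exists r => //; exists (r *: w - w').
  apply/killed_adjoin => //; split; first exact/killedB/kw'/killedZ.
  by rewrite scalerBr uw' scalerA mulrC -scalerA subrr.
by rewrite linearB linearZ /= dw dw' subr0.
Qed.

Lemma ext_van_right i : ext_van S i (colon a u) -> ext_van S i.+1 a ->
  ext_van S i.+1 (adjoin a u).
Proof.
move=> v1 v z az; have [_ SM] := Smul.
have [r Sr rz] := v z (cocycleS (@sub_adjoin _ a u) az).
have [s Ss srz] := cobound_adjoin v1 (cocycleZ r az) rz.
by exists (s * r); [exact: SM|rewrite -scalerA].
Qed.

Lemma ext_van_right0 : ext_van S 0 a -> ext_van S 0 (adjoin a u).
Proof. by move=> va z /cocycle_adjoin[//|/va]. Qed.

(** The connecting map sends the class of [z] to that of [d w], where [u *: w = z]. As that class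
    vanishes up to [S], a multiple of [w] can be corrected to a cocycle. *)
Lemma cocycle_colon_lift i z : ext_van S i.+1 (adjoin a u) ->
  cocycle i (colon a u) z ->
  exists2 r, S r & exists2 w, cocycle i a w & u *: w = r *: z.
Proof.
move=> v2 [az dz]; have [w aw uw] := killed_lift ia az.
have [|r Sr [w2 + dw2]] := v2 (d w).
  apply/cocycle_adjoin => //; split; first split.
  - exact: killed_diff.
  - exact: res_diffdiff.
  - by rewrite -linearZ /= uw.
move=> /killed_adjoin[//|aw2 uw2]; exists r => //; exists (r *: w - w2).
  split; first exact/killedB/aw2/killedZ.
  by rewrite linearB linearZ /= dw2 subrr.
by rewrite scalerBr uw2 subr0 scalerA mulrC -scalerA uw.
Qed.

Lemma ext_van_left i : ext_van S i a -> ext_van S i.+1 (adjoin a u) ->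
  ext_van S i (colon a u).
Proof.
move=> va v2 z /(cocycle_colon_lift v2)[r Sr [w /va[s Ss aw] uw]].
exists (s * r); first by case: Smul => _; apply.
rewrite -scalerA -uw scalerA mulrC -scalerA.
exact: cobound_colon.
Qed.

End LongExactSequence.

(* Submodules of [Ext^i(A/a, A)], as submodules of the cocycles that contain   *)
(* the coboundaries.                                                           *)
Definition ext_sub i a : set (set (E i)) := [set T |
  [/\ T `<=` cocycle i a, cobound i a `<=` T,
      forall z w, T z -> T w -> T (z + w) & forall r z, T z -> T (r *: z)]].

(** The argument that a module is noetherian if a submodule and the quotient by it are: make the
    image [f1] maximal, then the trace [f2]. *)
Lemma max_condition_map2 (V V1 V2 : Type) (C : set (set V))
    (C1 : set (set V1)) (C2 : set (set V2)) (f1 : set V -> set V1) (f2 : set V -> set V2) :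
  max_condition C1 -> max_condition C2 ->
  (forall T, C T -> C1 (f1 T)) -> (forall T, C T -> C2 (f2 T)) ->
  (forall T T', C T -> C T' -> T `<=` T' ->
     [/\ f1 T `<=` f1 T', f2 T `<=` f2 T' &
         f1 T' `<=` f1 T -> f2 T' `<=` f2 T -> T' `<=` T]) ->
  max_condition C.
Proof.
move=> m1 m2 Cf1 Cf2 mono F FC [T0 FT0].
have [||_ [T1 FT1 <-] max1] := m1 (f1 @` F).
- by move=> _ [T /FC/Cf1 ? <-].
- by exists (f1 T0), T0.
have [||_ [T2 [FT2 T12] <-] max2] := m2 (f2 @` [set T | F T /\ f1 T1 `<=` f1 T]).
- by move=> _ [T [/FC/Cf2 ? _] <-].
- by exists (f2 T1), T1; split.
exists T2 => // T FT T2T; have [s1 s2 s] := mono _ _ (FC _ FT2) (FC _ FT) T2T.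
have T1T : f1 T1 `<=` f1 T by apply: subset_trans s1.
apply: s; last by apply: max2 => //; exists T.
by apply: (subset_trans _ T12); apply: max1 => //; exists T.
Qed.

(** * Noetherianity of Ext and Nakayama's lemma at a prime *)

Section Noetherian.
Hypothesis acc : max_condition (@is_ideal A).

Lemma ext_noeth0 a : max_condition (@ext_sub 0 a).
Proof.
pose f (T : set (E 0%N)) : set A := [set x | T (e x)].
apply: (max_condition_map2 (f1 := f) (f2 := f) acc acc).
- move=> T [_ T0 TD TZ]; split=> [|x y Tx Ty|r x Tx]; rewrite /f /=.
  + by rewrite linear0; apply: T0.
  + by rewrite linearD; apply: TD.
  + by rewrite (linearZ_LR e r (x : A^o)); apply: TZ.
- move=> T [_ T0 TD TZ]; split=> [|x y Tx Ty|r x Tx]; rewrite /f /=.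
  + by rewrite linear0; apply: T0.
  + by rewrite linearD; apply: TD.
  + by rewrite (linearZ_LR e r (x : A^o)); apply: TZ.
move=> T T' _ [T'c _ _ _] TT'; split=> [x /TT'|x /TT'|fT _ z T'z] //.
by have /cocycle_aug[x xz _] := T'c _ T'z; rewrite -xz in T'z *; apply: fT.
Qed.

(** From the exact sequence Ext^i(A/(b : u)) -> Ext^(i+1)(A/(b, u)) -> Ext^(i+1)(A/b): [f1] is the
    image on the right, [f2] the preimage under the connecting map. *)
Lemma ext_noeth_step i b u : is_ideal b -> max_condition (@ext_sub i (colon b u)) ->
  max_condition (@ext_sub i.+1 b) -> max_condition (@ext_sub i.+1 (adjoin b u)).
Proof.
move=> ib m1 m2.
pose f1 (T : set (E i.+1)) := [set z | exists2 s, T s & cobound i.+1 b (z - s)].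
pose f2 (T : set (E i.+1)) := [set z : E i |
  killed i (colon b u) z /\ exists w, [/\ killed i b w, u *: w = z & T (d w)]].
apply: (max_condition_map2 (f1 := f1) (f2 := f2) m2 m1).
- move=> T [Tc Tb TD TZ]; split.
  + move=> z [s /Tc/cocycle_adjoin[//|bs _] zs].
    by rewrite -(subrK s z); apply: cocycleD => //; apply: cobound_cocycle.
  + move=> z bz; exists 0; last by rewrite subr0.
    by apply: Tb; apply: cobound0.
  + move=> z w [s Ts zs] [t Tt wt]; exists (s + t); first exact: TD.
    by rewrite opprD addrACA; apply: coboundD.
  + move=> r z [s Ts zs]; exists (r *: s); first exact: TZ.
    by rewrite -scalerBr; apply: coboundZ.
- move=> T [Tc Tb TD TZ]; split.
  + move=> z [kz [w [bw uw /Tc/cocycle_adjoin[//|_ udw]]]]; split=> //.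
    by rewrite -uw linearZ.
  + move=> z zb; split; first by case: (cobound_cocycle zb).
    have [w /cobound_cocycle[bw dw] uw] := cobound_lift ib zb.
    by exists w; split=> //; rewrite dw; apply: Tb; apply: cobound0.
  + move=> z w [kz [z' [bz uz Tz]]] [kw [w' [bw uw Tw]]]; split; first exact: killedD.
    exists (z' + w'); split; [exact: killedD|by rewrite scalerDr uz uw|].
    by rewrite linearD; apply: TD.
  + move=> r z [kz [z' [bz uz Tz]]]; split; first exact: killedZ.
    exists (r *: z'); split; [exact: killedZ| |by rewrite linearZ; apply: TZ].
    by rewrite scalerA mulrC -scalerA uz.
move=> T T' [Tc Tb TD TZ] [T'c T'b T'D T'Z] TT'; split.
- by move=> z [s /TT' T's zs]; exists s.
- by move=> z [kz [w [bw uw /TT' Tw]]]; split=> //; exists w.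
move=> s1 s2 z T'z; have [|s Ts [w bw dw]] := s1 z.
  by exists z => //; rewrite subrr; apply: cobound0.
rewrite -(subrK s z) -dw; apply: (TD) => //.
have T'dw : T' (d w).
  by rewrite dw; apply: T'D => //; rewrite -scaleN1r; apply/T'Z/TT'.
have [|_ [w' [bw' uw' Tw']]] := s2 (u *: w).
  by split; [exact: killed_colon|exists w].
rewrite -(subrK w' w) linearD; apply: TD => //; apply: Tb.
exists (w - w') => //; apply/killed_adjoin => //; split; first exact: killedB.
by rewrite scalerBr uw' subrr.
Qed.

Lemma ext_noeth i a : is_ideal a -> max_condition (@ext_sub i a).
Proof.
elim: i a => [a _|i IH a ia]; first exact: ext_noeth0.
apply: (ideal_chain_ind acc (Q := fun b => max_condition (@ext_sub i.+1 b))
  (@zero_ideal A) ia).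
- by case: ia => a0 _ _ _ ->.
- move=> F FC [T FT]; exists T => // T' FT' _.
  have [_ Tb _ _] := FC _ FT; have [T'c _ _ _] := FC _ FT'.
  move=> z /T'c[_ /res_exact[w dw]]; apply: Tb; exists w => // r ->.
  by rewrite scale0r.
- by move=> b u ib _ _ _; apply: ext_noeth_step => //; apply/IH/colon_ideal.
Qed.

(* The hypothesis says that [t] acts surjectively on [Ext^i(A/a, A)] localized *)
(* at [p]; [T] is maximal among the submodules with nonzero localized quotient. *)
Lemma ext_nakayama p t i a : is_prime p -> p t -> is_ideal a ->
  (forall z, cocycle i a z -> exists2 r, ~ p r &
     exists2 w, cocycle i a w & cobound i a (r *: z - t *: w)) ->
  ext_van (~` p) i a.
Proof.
move=> pp pt ia div; apply: contrapT => nv; have [[p0 pD pM] p1 pP] := pp.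
pose small (T : set (E i)) :=
  forall z, cocycle i a z -> exists2 r, ~ p r & T (r *: z).
have [||T [[Tc Tb TD TZ] nT] Tmax] := ext_noeth ia (F := [set T | ext_sub a T /\ ~ small T]) (i := i).
- by move=> T [].
- exists (cobound i a); split=> //; split=> //.
  + exact: cobound_cocycle.
  + exact: coboundD.
  + exact: coboundZ.
have tT z : cocycle i a z -> exists2 r, ~ p r & T (r *: (t *: z)).
  move=> az; have [Ttz|Ttz] := pselect (T (t *: z)).
    by exists 1 => //; rewrite scale1r.
  (* [T'] is T + A t z. If it is small, [T] contains (r - s t) t z for some r outside [p], and r - s
     t is outside [p] because [t] is in [p]. Otherwise maximality gives [T'] inside [T]. *)
  pose T' : set (E i) := [set w | exists2 r, T (w - r *: (t *: z)) & True].
  have [sT'|nT'] := pselect (small T').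
    have [r pr [s Trs _]] := sT' z az; exists (r - s * t).
      move=> prs; apply: pr; rewrite -(subrK (s * t) r).
      by apply: pD => //; apply: pM.
    rewrite scalerA mulrC -scalerA; apply: TZ.
    by rewrite scalerBl -scalerA.
  case: Ttz; apply: (Tmax T').
  - split=> //; split.
    + move=> w [r /Tc Tw _]; rewrite -(subrK (r *: (t *: z)) w).
      by apply: cocycleD => //; do 2! apply: cocycleZ.
    + by move=> w /Tb Tw; exists 0; rewrite // scale0r subr0.
    + move=> v w [r Tv _] [s Tw _]; exists (r + s) => //.
      by rewrite scalerDl opprD addrACA; apply: TD.
    + move=> s w [r Tw _]; exists (s * r) => //.
      by rewrite -[(s * r) *: _]scalerA -scalerBr; apply: TZ.
  - by move=> w Tw; exists 0; rewrite // scale0r subr0.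
  - by exists 1; rewrite // scale1r subrr; apply: Tb; apply: cobound0.
apply: nT => z az; have [r pr [w aw /Tb Trz]] := div z az.
have [s ps Tsw] := tT w aw; exists (s * r); first exact: prime_mul.
by rewrite -scalerA -(subrK (t *: w) (r *: z)) scalerDr; apply: TD => //; apply: TZ.
Qed.

(** An ideal [q] maximal with nonzero Ext at [p] is prime: if x y is in [q] but neither factor is,
    then (q : y) and (q, y) are strictly larger, and [ext_van_mid] gives vanishing for [q]. *)
Lemma ext_van_prime_witness p i b : is_prime p -> is_ideal b ->
  ~ ext_van (~` p) i b ->
  exists q, [/\ is_prime q, b `<=` q, q `<=` p & ~ ext_van (~` p) i q].
Proof.
move=> pp ib nv; have [ip p1 pP] := pp.
have Smul : mul_set (~` p) by split=> // x y; apply: prime_mul.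
have [||q [iq bq nq] qmax] :=
    acc (F := [set a | [/\ is_ideal a, b `<=` a & ~ ext_van (~` p) i a]]).
- by move=> a [].
- by exists b; split.
have qp : q `<=` p.
  by move=> x qx; apply: contrapT => px; apply: nq; apply: ext_van_killed qx.
exists q; split=> //; split=> //; first by move/qp.
move=> x y qxy; have [qx|qx] := pselect (q x); [by left|right].
apply: contrapT => qy; apply: nq; apply: (ext_van_mid (u := y)) => //.
  apply: contrapT => nv'; apply: qy; apply: (qmax (adjoin q y)).
  - split=> //; first exact: adjoin_ideal.
    exact: subset_trans bq (@sub_adjoin _ _ _).
  - exact: sub_adjoin.
  - exact: mem_adjoin.
apply: contrapT => nv'; apply: qx; apply: (qmax (colon q y)) => //.
- split=> //; first exact: colon_ideal.
  by apply: (subset_trans bq); apply: sub_colon.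
- exact: sub_colon.
Qed.

Definition ext_van_all p i : Prop :=
  forall a, is_ideal a -> ext_van (~` p) i a.

(** As [t] is regular on A/a, vanishing of Ext^(i+1)(A/(a, t)) makes [t] surjective on Ext^i(A/a) at
    [p]. *)
Lemma ext_nakayama_colon p t i a : is_prime p -> p t -> is_ideal a ->
  colon a t = a -> ext_van (~` p) i.+1 (adjoin a t) -> ext_van (~` p) i a.
Proof.
move=> pp pt ia at_ v; apply: (ext_nakayama pp pt ia) => z.
rewrite -{1}at_ => /(cocycle_colon_lift ia v)[r pr [w aw tw]].
by exists r => //; exists w => //; rewrite tw subrr; apply: cobound0.
Qed.

(** A nonzero Ext^i would occur for a prime [q] inside [p]. If [q] is not [p], an element of [p]
    outside [q] is regular on A/q and [ext_nakayama_colon] applies. *)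
Lemma ext_van_all_step p i : is_prime p -> ext_van_all p i.+1 ->
  ext_van (~` p) i p -> ext_van_all p i.
Proof.
move=> pp v1 vp a ia; apply: contrapT => /(ext_van_prime_witness pp ia)[q [qq _ qp nq]].
have [pq|/existsNP[t /not_implyP[pt qt]]] := pselect (p `<=` q).
  by apply: nq; have -> : q = p by apply/seteqP.
apply: nq; have [iq _ _] := qq; apply: (ext_nakayama_colon pp pt) => //.
  exact: colon_prime.
by apply: v1; apply: adjoin_ideal.
Qed.

Lemma ext_van_all_descend p l k : is_prime p ->
  (forall i, (l <= i)%N -> ext_van_all p i.+1 -> ext_van (~` p) i p) ->
  (l <= k)%N -> ext_van_all p k.
Proof.
move=> pp vp lk; have [_ p1 _] := pp.
suff H n i : (res_len E < i + n)%N -> (l <= i)%N -> ext_van_all p i.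
  by apply: (H (res_len E).+1); rewrite // addnS ltnS leq_addl.
elim: n i => [|n IH] i; first by rewrite addn0 => li _ a _; apply: ext_van_last.
move=> ln li; have v1 : ext_van_all p i.+1.
  by apply: IH; rewrite ?addSnnS // leqW.
by apply: ext_van_all_step => //; apply: vp.
Qed.

(** When [u] is adjoined to [c], the ideal (c : u) again contains [b], so its Ext one degree lower
    vanishes by induction. *)
Lemma ext_van_support S b k : mul_set S -> is_ideal b ->
  (forall i, (i < k)%N -> ext_van S i b) ->
  forall b', is_ideal b' -> b `<=` b' -> forall i, (i < k)%N -> ext_van S i b'.
Proof.
move=> Smul ib vb b' ib' bb' i; elim: i b' ib' bb' => [|i IH] b' ib' bb' ik.
  apply: (ideal_chain_ind acc (Q := ext_van S 0) ib ib' bb'); first exact: vb.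
  by move=> c u ic _ _ _ ; apply: ext_van_right0.
apply: (ideal_chain_ind acc (Q := ext_van S i.+1) ib ib' bb'); first exact: vb.
move=> c u ic bc _ _; apply: ext_van_right => //.
apply: IH; [exact: colon_ideal| |exact: ltnW].
by apply: (subset_trans bc); apply: sub_colon.
Qed.

(* Adjoining one element raises the grade by at most one.                      *)
Lemma ext_van_adjoin p a y k : is_prime p -> is_ideal a -> p y ->
  (forall i, (i <= k)%N -> ext_van (~` p) i (adjoin a y)) ->
  forall i, (i < k)%N -> ext_van (~` p) i a.
Proof.
move=> pp ia py v i ik; have [ip p1 _] := pp.
have Smul : mul_set (~` p) by split=> // r s; apply: prime_mul.
have icol : is_ideal (colon a y) by apply: colon_ideal.
apply: (ext_nakayama pp py ia) => z az.
(* Up to a factor outside [p] and a coboundary, [z] becomes a cocycle killed by (a : y): for [u] in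
   (a : y) the ideal (b : u) contains [a] and [y], so the obstruction in Ext^i(A/(b : u))
   vanishes. *)
have [r pr [z' cz' zz']] : exists2 r, ~ p r &
    exists2 z', cocycle i (colon a y) z' & cobound i a (r *: z - z').
  apply: (ideal_chain_ind acc (Q := fun b => exists2 r, ~ p r &
      exists2 z', cocycle i b z' & cobound i a (r *: z - z')) ia icol).
  - exact: sub_colon.
  - by exists 1 => //; exists z; rewrite // scale1r subrr; apply: cobound0.
  move=> b u ib ab _ ayu [r pr [z' bz' zz']].
  have [|s ps] := ext_van_support (k := k.+1) Smul (adjoin_ideal y ia) v
      (colon_ideal u ib) _ (ltnW ik) (cocycle_colon u bz').
    apply: adjoin_min; [exact: colon_ideal| |].
      by apply: (subset_trans ab); apply: sub_colon.
    by apply: ab; rewrite mulrC.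
  move=> /(cobound_lift ib)[w bw uw].
  exists (s * r); first exact: prime_mul.
  exists (s *: z' - w).
    apply/cocycle_adjoin => //; split.
      by apply: cocycleB; [exact: cocycleZ|exact: cobound_cocycle].
    by rewrite scalerBr uw scalerA mulrC -scalerA subrr.
  rewrite opprB addrCA -scalerA -scalerBr; apply: coboundD.
    exact: coboundS ab _ bw.
  exact: coboundZ.
have [s ps [w aw yw]] := cocycle_colon_lift ia (v i.+1 ik) cz'.
exists (s * r); first exact: prime_mul.
by exists w => //; rewrite yw -scalerA -scalerBr; apply: coboundZ.
Qed.

End Noetherian.
End Ext.

(** * Regular sequences *)

Section RegularChain.
Variable A : comPzRingType.
Implicit Types (a b c : set A) (l : nat).

(* [b] is [b0] plus the ideal of a sequence of length [l] regular on [A/b0].   *)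
Fixpoint regular_chain b0 l b : Prop :=
  match l with
  | 0%N => b = b0
  | k.+1 => exists c x, [/\ regular_chain b0 k c, colon c x = c & b = adjoin c x]
  end.

Lemma regular_chain_ideal b0 l b : is_ideal b0 -> regular_chain b0 l b -> is_ideal b.
Proof.
move=> ib0; elim: l b => [b ->|l IH b [c [x [/IH ic _ ->]]]] //.
exact: adjoin_ideal.
Qed.

Lemma colon_regular c x : is_ideal c -> (forall r, c (r * x) -> c r) -> colon c x = c.
Proof. by move=> ic xc; apply/seteqP; split=> [r /xc|] //; apply: sub_colon. Qed.

Variable E : resolution A.

Lemma mul_set1 : @mul_set A [set 1].
Proof. by split=> // x y -> ->; rewrite /= mulr1. Qed.

Lemma ext_van1 S i b : S 1 -> ext_van E [set 1] i b -> ext_van E S i b.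
Proof. by move=> S1; apply: ext_vanS => _ ->. Qed.

(* The class of [g] identifies [Ext^l(A/b, A)] with [A/b].                     *)
Lemma ext_regular_chain l b : regular_chain [set 0] l b ->
  (forall i, i <> l -> ext_van E [set 1] i b) /\
  exists g : E l, [/\ cocycle b g,
    forall z, cocycle b z -> exists r, cobound b (z - r *: g) &
    forall r, cobound b (r *: g) -> b r].
Proof.
elim: l b => [_ ->|l IH _ [c [x [rc xc ->]]]].
  split.
    case=> [//|i] _ z [_ /res_exact[w dw]]; exists 1 => //.
    by rewrite scale1r; exists w => // r ->; rewrite scale0r.
  exists (res_aug E 1); split.
  - by apply/cocycle_aug; exists 1 => // r ->; rewrite mul0r.
  - move=> z /cocycle_aug[r rz _]; exists r => /=.
    by rewrite -linearZ /= [r *: _]mulr1 rz subrr.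
  - move=> r /=; rewrite -linearZ /= [r *: _]mulr1 => er.
    by apply: (@res_aug_inj A E); rewrite er linear0.
have ic := regular_chain_ideal (@zero_ideal A) rc.
have [vc [g [cg gen ann]]] := IH c rc.
have killg r : c r -> r *: g = 0 by case: cg => kg _; apply: kg.
have xreg r : c (x * r) -> c r by move=> cxr; rewrite -xc /colon /= mulrC.
(* [x] acts injectively on Ext^l(A/c) = A/c, so a class killed by [x] is 0. *)
have cob z : cocycle (adjoin c x) z -> cobound c (z : E l).
  move=> /cocycle_adjoin[//|cz xz]; have [r zr] := gen z cz.
  have cr : c r.
    apply/xreg/ann; have := coboundZ (- x) zr.
    by rewrite scalerBr !scaleNr xz oppr0 sub0r opprK scalerA.
  by move: zr; rewrite killg // subr0.
split.
  case=> [|i] il.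
    case: l {IH rc} vc g cg gen ann killg cob {il} => [|l] vc g cg gen ann killg cob.
      by move=> z /cob ->; exists 1; rewrite // scaler0; apply: cobound0.
    by apply: ext_van_right0 => //; apply: vc.
  have il' : i <> l by move=> il'; apply: il; rewrite il'.
  have vi : ext_van E [set 1] i (colon c x) by rewrite xc; apply: vc.
  have [il1|il1] := pselect (i.+1 = l); last first.
    by apply: ext_van_right => //; [exact: mul_set1|apply: vc].
  by move: cob; rewrite -il1 => cob z zc; apply: cobound_adjoin => //; apply: cob.
(* The new generator is the image of [g] under the connecting map: the differential of some [h] with
   [x *: h = g]. *)
have [|h ch xh] := @killed_lift A E l c x g ic; first by rewrite xc; case: cg.
have adj_dh : cocycle (adjoin c x) (res_diff E l h).
  apply/cocycle_adjoin => //; split; first split.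
  - exact: killed_diff.
  - exact: res_diffdiff.
  - by rewrite -linearZ /= xh; case: cg.
exists (res_diff E l h); split=> //.
- move=> z /cocycle_adjoin[//|cz xz]; have [|_ -> ] := vc l.+1 _ z cz.
    by move=> /eqP; rewrite -{2}[l]addn0 -addn1 eqn_add2l.
  rewrite scale1r => -[w cw dw].
  have [|r rg] := gen (x *: w).
    split; last by rewrite linearZ /= dw.
    by rewrite -xc; apply: killed_colon.
  exists r; rewrite -dw -linearZ -linearB.
  have : cobound (colon c x) (x *: (w - r *: h)).
    by rewrite xc scalerBr scalerA [x * r]mulrC -scalerA xh.
  move=> /(cobound_lift ic)[v /cobound_cocycle[cv dv] xv].
  exists (w - r *: h - v); last by rewrite [LHS]linearB dv subr0.
  apply/killed_adjoin => //; split; last by rewrite scalerBr xv subrr.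
  by apply: killedB => //; apply: killedB => //; apply: killedZ.
- move=> r [w /killed_adjoin[//|cw xw] dw].
  have [|s rs] := gen (r *: h - w).
    split; first by apply: killedB => //; apply: killedZ.
    by rewrite linearB dw -linearZ subrr.
  exists s; apply: ann.
  have := cobound_colon x rs; rewrite xc !scalerBr xw subr0.
  by rewrite scalerA [x * r]mulrC -scalerA xh scalerA -scalerBl [x * s]mulrC.
Qed.


(** * Unmixedness, and vanishing of Ext along regular sequences *)

Section Noetherian.
Hypothesis acc : max_condition (@is_ideal A).

(** Multiplication by [w] embeds A/p in A/a, so Ext^j(A/p) lies between Ext^j(A/a) = 0 and
    Ext^(j+1)(A/(a, w)), which is 0 at [p] by descending induction. *)
Lemma ext_van_all_associated p l a w : regular_chain [set 0] l a ->
  is_prime p -> colon a w = p -> forall i, (l < i)%N -> ext_van_all E p i.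
Proof.
move=> ra pp awp i li; apply: (ext_van_all_descend acc pp _ li) => j lj vj.
have [ip p1 _] := pp; have ia := regular_chain_ideal (@zero_ideal A) ra.
have Smul : mul_set (~` p) by split=> // x y; apply: prime_mul.
rewrite -{2}awp; apply: ext_van_left => //; last exact/vj/adjoin_ideal.
apply: ext_van1 => //; apply: (ext_regular_chain ra).1 => jl.
by rewrite jl ltnn in lj.
Qed.

Lemma ext_chain_neq0 p l a : regular_chain [set 0] l a -> a `<=` p ->
  ~ ext_van E (~` p) l a.
Proof.
move=> /ext_regular_chain[_ [g [cg _ ann]]] ap /(_ g cg)[r pr /ann/ap].
exact: pr.
Qed.

Lemma colon_sub_prime p a w : is_ideal a -> colon a w = p -> a `<=` p.
Proof. by move=> ia <-; apply: sub_colon. Qed.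

(** For [t] in [p] outside [q], Nakayama's lemma gives Ext^l(A/q) = 0 at [p]. As lower Ext vanish,
    this spreads along a chain of ideals to [p], then to all ideals, against Ext^l(A/a) = A/a. *)
Lemma regular_chain_unmixed p q l a w : regular_chain [set 0] l a ->
  is_prime p -> colon a w = p -> is_prime q -> a `<=` q -> q `<=` p -> p `<=` q.
Proof.
move=> ra pp awp pq aq qp t pt; apply: contrapT => qt.
have [ip p1 _] := pp; have [iq _ _] := pq.
have ia := regular_chain_ideal (@zero_ideal A) ra.
have Smul : mul_set (~` p) by split=> // x y; apply: prime_mul.
have vp := ext_van_all_associated ra pp awp.
have vq : ext_van E (~` p) l q.
  apply: (ext_nakayama_colon acc pp pt) => //; first exact: colon_prime.
  by apply: vp => //; apply: adjoin_ideal.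
apply: (ext_chain_neq0 ra (subset_trans aq qp)).
apply: (ext_van_all_step acc pp (vp l.+1 (ltnSn l))) => //.
apply: (ideal_chain_ind acc (Q := ext_van E (~` p) l) iq ip qp) => // b u ib qb bp pu vb.
case: l ra vp vq vb => [|l] ra vp vq vb; first exact: ext_van_right0.
apply: ext_van_right => //.
apply: (ext_van_support acc (k := l.+1) Smul ia) => //; first last.
- apply: subset_trans aq _; apply: subset_trans qb _; exact: sub_colon.
- exact: colon_ideal.
move=> i il; apply: ext_van1 => //; apply: (ext_regular_chain ra).1 => il1.
by rewrite il1 ltnn in il.
Qed.

(** A regular chain cannot outgrow the resolution, since Ext^l(A/b) = A/b is nonzero. *)
Lemma exists_maximal_chain m : is_prime m ->
  exists l b w, [/\ regular_chain [set 0] l b, b `<=` m, ~ b w & m `<=` colon b w].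
Proof.
move=> pm; have [im m1 _] := pm.
suff H k l b : (res_len E < l + k)%N -> regular_chain [set 0] l b -> b `<=` m ->
  exists l b w, [/\ regular_chain [set 0] l b, b `<=` m, ~ b w & m `<=` colon b w].
  apply: (H (res_len E).+1 0%N [set 0]) => // x ->.
  by case: im.
elim: k l b => [|k IH] l b lk rb bm.
  have [_ [g [_ _ ann]]] := ext_regular_chain rb.
  case: m1; apply/bm/ann; apply: cobound_last.
  by rewrite addn0 in lk.
have ib := regular_chain_ideal (@zero_ideal A) rb.
have [[x mx bx]|[w bw mw]] := regular_or_killed acc ib im; last by exists l, b, w.
apply: (IH l.+1 (adjoin b x)); first by rewrite addSnnS.
  by exists b, x; split=> //; apply: colon_regular.
exact: adjoin_min.
Qed.

Lemma ext_van_chain_above p b0 l b k : is_prime p -> is_ideal b0 ->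
  regular_chain b0 l b -> b `<=` p ->
  (forall i, (k + l < i)%N -> ext_van E (~` p) i b) ->
  forall i, (k < i)%N -> ext_van E (~` p) i b0.
Proof.
move=> pp ib0; elim: l b => [b -> _|l IH b [c [x [rc xc ->]]] bp vb].
  by rewrite addn0.
have ic := regular_chain_ideal ib0 rc; apply: IH rc _ _.
  by apply: subset_trans bp; apply: sub_adjoin.
move=> i ki; apply: (ext_nakayama_colon acc pp _ ic xc).
  exact/bp/mem_adjoin.
by apply: vb; rewrite addnS ltnS.
Qed.

Lemma ext_van_chain_below p b0 l b k : is_prime p -> is_ideal b0 ->
  regular_chain b0 l b -> b `<=` p ->
  (forall i, (i < k + l)%N -> ext_van E (~` p) i b) ->
  forall i, (i < k)%N -> ext_van E (~` p) i b0.
Proof.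
move=> pp ib0; elim: l b => [b -> _|l IH b [c [x [rc xc ->]]] bp vb].
  by rewrite addn0.
have ic := regular_chain_ideal ib0 rc; apply: IH rc _ _.
  by apply: subset_trans bp; apply: sub_adjoin.
apply: (ext_van_adjoin acc pp ic); first exact/bp/mem_adjoin.
by move=> i; rewrite -ltnS -addnS; apply: vb.
Qed.

End Noetherian.
End RegularChain.

(** * Codimension one *)

Definition is_local_at (A : comPzRingType) (m : set A) : Prop :=
  is_prime m /\ forall c, ~ m c -> exists r, r * c = 1.

Lemma prime_sub_local (A : comPzRingType) (m p : set A) :
  is_local_at m -> is_ideal p -> ~ p 1 -> p `<=` m.
Proof.
move=> [_ unit] [_ _ pM] p1 x px; apply: contrapT => /unit[r rx].
by apply: p1; rewrite -rx; apply: pM.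
Qed.

Section LocalResolution.
Variables (A : comPzRingType) (E : resolution A).
Hypothesis acc : max_condition (@is_ideal A).

Lemma exists_socle_chain (m : set A) : is_local_at m ->
  exists l b w, regular_chain [set 0] l b /\ colon b w = m.
Proof.
move=> lm; have [pm _] := lm.
have [l [b [w [rb bm bw mw]]]] := exists_maximal_chain E acc pm.
exists l, b, w; split=> //; apply/seteqP; split=> //.
apply: (prime_sub_local lm); last by rewrite /colon /= mul1r.
exact/colon_ideal/(regular_chain_ideal (@zero_ideal A) rb).
Qed.

Lemma exists_parameter_chain (m : set A) : is_local_at m ->
  exists l b, [/\ regular_chain [set 0] l b, b `<=` m &
    forall q, is_prime q -> b `<=` q -> m `<=` q].
Proof.
move=> lm; have [pm _] := lm; have [l [b [w [rb bwm]]]] := exists_socle_chain lm.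
exists l, b; split=> //.
  apply: colon_sub_prime bwm; exact: regular_chain_ideal (@zero_ideal A) rb.
move=> q pq bq; apply: (regular_chain_unmixed E acc rb pm bwm pq bq).
by have [iq q1 _] := pq; apply: (prime_sub_local lm).
Qed.

Section Codimension.
Variables m I : set A.
Hypotheses (lm : is_local_at m) (iI : is_ideal I).
Hypothesis parameters : exists l b, [/\ regular_chain I l b, b `<=` m &
  forall q, is_prime q -> b `<=` q -> m `<=` q].
Hypothesis codim_ge1 : forall p, is_prime p -> I `<=` p ->
  exists q, [/\ is_prime q, q `<=` p & ~ (p `<=` q)].
Hypothesis codim_le1 : exists p, [/\ is_prime p, I `<=` p &
  forall q q', is_prime q -> is_prime q' -> q' `<=` q -> ~ (q `<=` q') ->
    q `<=` p -> p `<=` q].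

(** Otherwise some prime (0 : w) contains [I]; by unmixedness it is a minimal prime, against
    codimension at least one. *)
Lemma codim_faithful x : (forall c, I c -> c * x = 0) -> x = 0.
Proof.
move=> Ix; apply: contrapT => x0.
have [|||w Iw pw] := colon_prime_exists acc (b := [set 0])
    (X := [set y | forall c, I c -> c * y = 0]).
- exact: zero_ideal.
- by move=> c y Iy r Ir /=; rewrite mulrCA Iy // mulr0.
- by exists x.
have [q [pq qp npq]] := codim_ge1 pw Iw; apply: npq.
apply: (regular_chain_unmixed E (l := 0%N) (a := [set 0]) (w := w) acc) => //.
by move=> y ->; have [[]] := pq.
Qed.

(** Let [x] in [I] be regular. Some [w] outside (x) satisfies w I in (x), and [w] times the
    generator [g] of Ext^1(A/(x)) = A/(x) is a nonzero class of Ext^1(A/I). *)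
Lemma codim_ext1_neq0 : ~ ext_van E (~` m) 1 I.
Proof.
have i0 := @zero_ideal A; have [p [pp Ip pmin]] := codim_le1.
have [[x Ix xreg]|[w w0 Iw]] := regular_or_killed acc i0 iI; last first.
  by case: w0; apply: codim_faithful => c /Iw.
have x0 : colon [set 0] x = [set 0] by apply: colon_regular.
have ra : regular_chain [set 0] 1 (adjoin [set 0] x) by exists [set 0], x.
have ia := adjoin_ideal x i0.
have aI : adjoin [set 0] x `<=` I.
  by apply: adjoin_min => // y ->; case: iI.
have [[u Iu ureg]|[w aw Iw]] := regular_or_killed acc ia iI.
  (* No [u] in [I] is regular modulo [x]: a prime [q] = ((x) : w) inside [p] strictly contains some
     prime (0 : w'), so it contains [p], hence [u]. *)
  have [w [pq qp]] := colon_prime_below acc ia pp (subset_trans aI Ip).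
  set q := colon _ w in pq qp; have [iq q1 _] := pq.
  have xq : q x by apply: (sub_colon w ia); apply: mem_adjoin.
  have [w' [pq' q'q]] : exists w', is_prime (colon [set 0] w') /\ colon [set 0] w' `<=` q.
    by apply: colon_prime_below => // y ->; case: iq.
  have [_ q'1 _] := pq'.
  have nqq' : ~ (q `<=` colon [set 0] w').
    move=> /(_ x xq) xw'; apply: q'1; rewrite /colon /= mul1r.
    by apply: xreg; rewrite mulrC.
  have /(_ u (Ip u Iu)) uw := pmin q _ pq pq' q'q nqq' qp.
  case: q1; rewrite /q /colon /= mul1r.
  by apply: ureg; rewrite mulrC.
have [_ [g [cg _ ann]]] := ext_regular_chain E ra.
have [pm unit] := lm.
move=> /(_ (w *: g)) []; first split.
- by move=> c /Iw cw; rewrite scalerA; case: cg => kg _; apply: kg.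
- by case: cg => _ dg; rewrite linearZ /= dg scaler0.
move=> r /unit[s sr] /(coboundS aI); rewrite scalerA => /ann arw.
apply: aw; rewrite -[w]mul1r -sr -mulrA.
by case: ia => _ _; apply.
Qed.

(** If [n] exceeded l + 1, Ext^j(A/b) would vanish at [m] for j < l + 2, and dropping the l regular
    elements would give Ext^1(A/I) = 0. So every Ext^j with j > l + 1 vanishes at [m], and dropping
    them leaves i > 1. *)
Lemma codim_ext_van i : (1 < i)%N -> ext_van E (~` m) i I.
Proof.
have i0 := @zero_ideal A; have [l [b [rb bm bmax]]] := parameters.
have [n [a [w [ra awm]]]] := exists_socle_chain lm.
have [pm unit] := lm; have ib := regular_chain_ideal iI rb.
have Smul : mul_set (~` m).
  by have [_ m1 _] := pm; split=> // x y; apply: prime_mul.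
have ia := regular_chain_ideal i0 ra.
have am := colon_sub_prime ia awm.
have vn : (n <= l.+1)%N.
  rewrite leqNgt; apply/negP => ln; apply: codim_ext1_neq0.
  apply: (ext_van_chain_below acc (k := 2) pm iI rb bm) => // j jl.
  apply: contrapT => /(ext_van_prime_witness acc pm ib)[q [pq bq qm nq]].
  apply: nq; have -> : q = m by apply/seteqP; split=> //; apply: bmax.
  apply: (ext_van_support acc (k := n) Smul ia _ _ am).
  - move=> k kn; apply: ext_van1; first by case: Smul.
    apply: (ext_regular_chain E ra).1 => kn'.
    by rewrite kn' ltnn in kn.
  - by case: pm.
  - by apply: leq_trans ln; rewrite -addn2 addnC.
apply: (ext_van_chain_above acc (k := 1) pm iI rb bm) => j lj.
apply: (ext_van_all_associated acc ra pm awm) => //.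
by apply: leq_ltn_trans lj; rewrite add1n.
Qed.

End Codimension.
End LocalResolution.

(** * Gorenstein local rings *)

Section IdealOfSet.
Variables (A : comPzRingType) (a : set A).
Hypothesis ia : is_ideal a.

Definition ideal_pred of is_ideal a : {pred A^o} := fun x => `[< a x >].

Fact ideal_pred_closed : GRing.subsemimod_closed (ideal_pred ia).
Proof.
have [a0 aD aM] := ia; split; [split|].
- exact/asboolP.
- by move=> x y /asboolP ax /asboolP ay; apply/asboolP; apply: aD.
- by move=> c x /asboolP ax; apply/asboolP; apply: aM.
Qed.
HB.instance Definition _ :=
  GRing.isSubmodClosed.Build A A^o (ideal_pred ia) ideal_pred_closed.

Definition ideal_of : ideal A := ideal_pred ia.

Lemma ideal_ofE x : (x \in ideal_of) = `[< a x >].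
Proof. by []. Qed.

End IdealOfSet.

Section IdealConversions.
Variable A : comPzRingType.
Implicit Types I : ideal A.

Definition ideal_set I : set A := [set x | x \in I].

Lemma ideal_setP I : is_ideal (ideal_set I).
Proof.
split; rewrite /ideal_set /=.
- exact: (@rpred0 _ (submodule_pred I)).
- by move=> x y; apply: (@rpredD _ (submodule_pred I)).
- by move=> c x; apply: (@rpredZ _ _ (submodule_pred I)).
Qed.

Lemma ideal_set_prime I : prime_ideal I -> is_prime (ideal_set I).
Proof. by move=> [/negP I1 IM]; split=> //; apply: ideal_setP. Qed.

Lemma ideal_of_prime (p : set A) (pp : is_prime p) :
  prime_ideal (ideal_of (let: And3 ip _ _ := pp in ip)).
Proof.
case: pp => ip p1 pP; split; first by rewrite ideal_ofE; apply/asboolP.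
by move=> x y; rewrite !ideal_ofE => /asboolP/pP[px|py]; [left|right]; apply/asboolP.
Qed.

Lemma noetherian_max : noetherian A -> max_condition (@is_ideal A).
Proof.
move=> noeth F FI [a0 Fa0]; apply: contrapT => nmax.
have next (a : {a | F a}) : exists b : {a | F a},
    sval a `<=` sval b /\ ~ (sval b `<=` sval a).
  apply: contrapT => nb; apply: nmax; exists (sval a) => [|b Fb ab]; first exact: svalP.
  by apply: contrapT => ba; apply: nb; exists (exist _ b Fb).
have [g gP] := choice next.
pose s n := sval (iter n g (exist _ a0 Fa0)).
have Fs n : F (s n) by apply: svalP.
have is_ n : is_ideal (s n) by apply/FI/Fs.
have smono i j : (i <= j)%N -> s i `<=` s j.
  move=> /subnK <-; elim: (j - i)%N => [//|k IH].
  by apply: subset_trans IH _; rewrite addSn; case: (gP (iter (k + i) g (exist _ a0 Fa0))).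
pose U : set A := [set x | exists n, s n x].
have iU : is_ideal U.
  split; first by exists 0%N; case: (is_ 0%N).
  - move=> x y [i ix] [j jy]; exists (maxn i j); have [_ sD _] := is_ (maxn i j).
    by apply: sD; [apply: smono ix; rewrite leq_maxl|apply: smono jy; rewrite leq_maxr].
  - by move=> c x [i ix]; exists i; have [_ _ sM] := is_ i; apply: sM.
have [l lP] := noeth (ideal_of iU).
have [n ln] : exists n, forall x, x \in l -> s n x.
  have : forall x, x \in l -> U x.
    by move=> x xl; apply/asboolP; rewrite -(ideal_ofE iU) lP; apply: mem_ideal_gen.
  elim: l {lP} => [_|x l IH lU]; first by exists 0%N.
  have [|n nl] := IH; first by move=> y yl; apply: lU; rewrite inE yl orbT.
  have [k kx] := lU x (mem_head _ _).
  exists (maxn k n) => y; rewrite inE => /predU1P[->|/nl].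
    by apply: smono kx; rewrite leq_maxl.
  by apply: smono; rewrite leq_maxr.
have [_] := gP (iter n g (exist _ a0 Fa0)); apply => x snx.
have : x \in ideal_of iU by rewrite ideal_ofE; apply/asboolP; exists n.+1.
rewrite lP => /asboolP[r rl ->].
have [s0 sD sM] := is_ n.
elim: r rl => [|y r IH] rl; first by rewrite big_nil.
rewrite big_cons; apply: sD.
  by apply/sM/ln/rl/mem_head.
by apply: IH => z zr; apply: rl; rewrite inE zr orbT.
Qed.

Lemma local_ring_at : max_condition (@is_ideal A) -> local_ring A ->
  exists m : set A, is_local_at m.
Proof.
move=> acc [m [/negP m1 mmax] muniq]; exists (ideal_set m).
have im := ideal_setP m.
have unit c : ~ ideal_set m c -> exists r, r * c = 1.
  move=> mc; apply: contrapT => nr.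
  have i0 := @zero_ideal A.
  have [||M [iM M1 Mc] Mmax] := acc [set a | [/\ is_ideal a, ~ a 1 & a c]].
  - by move=> a [].
  - exists (adjoin [set 0] c); split; [exact: adjoin_ideal| |exact: mem_adjoin].
    by move=> [r /eqP]; rewrite subr_eq0 => /eqP rc; apply: nr; exists r.
  apply: mc; rewrite /ideal_set /= -(muniq (ideal_of iM)).
    by rewrite ideal_ofE; apply/asboolP.
  split; first by rewrite ideal_ofE; apply/negP => /asboolP.
  move=> J MJ /negP J1 x; apply/idP/idP; last exact: MJ.
  rewrite ideal_ofE => Jx; apply/asboolP; apply: (Mmax (ideal_set J)) => //.
    split=> //; first exact: ideal_setP.
    by apply: MJ; rewrite ideal_ofE; apply/asboolP.
  by move=> y My; apply: MJ; rewrite ideal_ofE; apply/asboolP.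
split=> //; split=> // x y mxy.
have [mx|/unit[r rx]] := pselect (ideal_set m x); [by left|right].
rewrite -[y]mul1r -rx -mulrA.
by have [_ _ mM] := im; apply: mM.
Qed.

(** Sending an element of (a, u) congruent to r u modulo [a] to r z is well defined; extend this map
    to A and let [w] be the image of 1. *)
Lemma injective_lift (E : lmodType A) (a : set A) u (z : E) :
  injective_module E -> is_ideal a -> (forall c, a (c * u) -> c *: z = 0) ->
  exists2 w, forall c, a c -> c *: w = 0 & u *: w = z.
Proof.
move=> injE ia az; have [a0 aD aM] := ia.
pose J := ideal_of (adjoin_ideal u ia).
have Jval (x : submodule J) : exists r, a (val x - r * u).
  by have := valP x; rewrite ideal_ofE => /asboolP.
have [g gP] := choice Jval.
have uniq r s : a (r * u - s * u) -> r *: z = s *: z.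
  by move=> ars; apply/eqP; rewrite -subr_eq0 -scalerBl az // mulrBl.
have lin : linear (fun x : submodule J => g x *: z).
  move=> c x y; rewrite scalerA -scalerDl; apply: uniq.
  have -> : g (c *: x + y) * u - (c * g x + g y) * u =
      c * (val x - g x * u) + (val y - g y * u) - (val (c *: x + y) - g (c *: x + y) * u).
    have -> : val (c *: x + y) = c * val x + val y :> A by rewrite linearP.
    by ring.
  by apply: is_idealB => //; apply: aD => //; apply: aM.
pose L : {linear submodule J -> E} := HB.pack (fun x : submodule J => g x *: z)
  (GRing.isLinear.Build A _ _ _ _ lin).
have [h hP] := injE _ _ (val : {linear submodule J -> A^o}) L val_inj.
have hE (x : A) (Jx : x \in J) : exists2 r, a (x - r * u) & x *: h 1 = r *: z.
  pose y := SubmoduleElt Jx; exists (g y); first exact: (gP y).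
  by rewrite -linearZ /= [x *: _]mulr1; apply: (hP y).
exists (h 1) => [c ac|].
  have [|r ar ->] := hE c.
    by rewrite ideal_ofE; apply/asboolP; apply: sub_adjoin.
  by apply: az; rewrite -(opprB (r * u)) in ar; have := is_idealB ia ac ar; rewrite opprK subrKC.
have [|r ar ->] := hE u; first by rewrite ideal_ofE; apply/asboolP; apply: mem_adjoin.
by rewrite -[RHS]scale1r; apply: uniq; rewrite mul1r -opprB; apply: is_idealN.
Qed.

Lemma finite_injective_resolution : finite_injective_dimension A^o ->
  exists E : resolution A, True.
Proof.
move=> [n [E [e [d [injE inje ex0 ex bound]]]]].
by exists (@Resolution A E e d n inje ex0 ex bound (fun i a u z => injective_lift (injE i))).
Qed.

Lemma gorenstein_local_resolution : gorenstein_local_ring A ->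
  exists (E : resolution A) (m : set A), max_condition (@is_ideal A) /\ is_local_at m.
Proof.
move=> [/noetherian_max acc /(local_ring_at acc)[m lm]].
by move=> /finite_injective_resolution[E _]; exists E, m.
Qed.

End IdealConversions.

(** * Lifting parameters from the quotient ring *)

Section QuotientParameters.
Variables (A : comPzRingType) (I : ideal A).
Local Notation D := (quotient_ring I).
Local Notation pi := (quotient_proj I).

Lemma quotient_proj_eq0 x : pi x = 0 <-> x \in I.
Proof. by rewrite -(raddf0 pi) quotient_proj_eq subr0. Qed.

Lemma preimage_ideal (b : set D) : is_ideal b -> is_ideal [set x | b (pi x)].
Proof.
move=> [b0 bD bM]; split=> /=; first by rewrite raddf0.
- by move=> x y bx by_; rewrite raddfD; apply: bD.
- by move=> c x bx; rewrite rmorphM; apply: bM.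
Qed.

Lemma image_prime (q : set A) : is_prime q -> ideal_set I `<=` q ->
  is_prime (pi @` q) /\ forall x, (pi @` q) (pi x) -> q x.
Proof.
move=> [[q0 qD qM] q1 qP] Iq.
have mem x : (pi @` q) (pi x) -> q x.
  move=> [y qy /esym/quotient_proj_eq xy].
  by rewrite -(subrK y x); apply: qD => //; apply: Iq.
split=> //; split; [split| |].
- by exists 0; rewrite // raddf0.
- by move=> _ _ [x qx <-] [y qy <-]; exists (x + y); rewrite ?raddfD //; apply: qD.
- move=> c _ [x qx <-]; have [r <-] := quotient_projP c.
  by exists (r * x); rewrite ?rmorphM //; apply: qM.
- by rewrite -(rmorph1 pi) => /mem.
- move=> x y; have [r <-] := quotient_projP x; have [s <-] := quotient_projP y.
  by rewrite -rmorphM => /mem/qP[qr|qs]; [left; exists r|right; exists s].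
Qed.

Lemma preimage_regular_chain l (b : set D) : regular_chain [set 0] l b ->
  regular_chain (ideal_set I) l [set x | b (pi x)].
Proof.
elim: l b => [b ->|l IH _ [c [y [rc cy ->]]]].
  by apply/seteqP; split=> x /quotient_proj_eq0.
have ic := regular_chain_ideal (@zero_ideal D) rc.
have [x xy] := quotient_projP y; rewrite -{}xy in cy *.
exists [set r | c (pi r)], x; split; first exact: IH.
  apply/seteqP; split=> r; rewrite /colon /= rmorphM => cr.
    by rewrite -cy.
  exact: (is_idealMr _ ic cr).
apply/seteqP; split=> r /=.
  move=> [s]; have [t <-] := quotient_projP s; rewrite -rmorphM -raddfB => cr.
  by exists t.
by move=> [s cr]; exists (pi s); rewrite -rmorphM -raddfB.
Qed.

Lemma quotient_parameters (m : set A) : is_local_at m ->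
  gorenstein_local_ring D ->
  exists l b, [/\ regular_chain (ideal_set I) l b, b `<=` m &
    forall q, is_prime q -> b `<=` q -> m `<=` q].
Proof.
move=> lm /gorenstein_local_resolution[E [mD [acc lD]]].
have [l [b [rb bm bmax]]] := exists_parameter_chain E acc lD.
have ib := regular_chain_ideal (@zero_ideal D) rb.
have [[imD mD1 mDP] unit] := lD; have [pm munit] := lm.
have mDm x : mD (pi x) -> m x.
  apply: (prime_sub_local lm (preimage_ideal imD)) => /=.
  by rewrite rmorph1.
have Im x : x \in I -> m x.
  by move=> /quotient_proj_eq0 Ix; apply: mDm; rewrite Ix; case: imD.
exists l, [set x | b (pi x)]; split; first exact: preimage_regular_chain.
  by move=> x /bm/mDm.
move=> q pq bq x mx.
have Iq : ideal_set I `<=` q.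
  by move=> y /quotient_proj_eq0 Iy; apply: bq => /=; rewrite Iy; case: ib.
have [ppq qmem] := image_prime pq Iq.
apply: qmem; apply: (bmax _ ppq).
  by move=> y by_; have [r ry] := quotient_projP y; exists r => //; apply: bq; rewrite /= ry.
apply: contrapT => /unit[s]; have [r <-] := quotient_projP s.
rewrite -rmorphM -(rmorph1 pi) => /quotient_proj_eq/Im mrx.
have [im m1 _] := pm; have [_ _ mM] := im; apply: m1.
by rewrite -(subKr (r * x) 1); apply: is_idealB => //; apply: mM.
Qed.

End QuotientParameters.

Section Codimension.
Variables (A : comPzRingType) (I : ideal A).
Hypothesis codim1 : has_codimension I 1.

Lemma codimension_ge1 p : is_prime p -> ideal_set I `<=` p ->
  exists q, [/\ is_prime q, q `<=` p & ~ (p `<=` q)].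
Proof.
move=> pp Ip; have [ge1 _] := codim1.
have [|c [c_prime c_lt c_last]] := ge1 _ (ideal_of_prime pp).
  by move=> x /Ip px; rewrite ideal_ofE; apply/asboolP.
have cp x : (x \in c 1%N) <-> p x.
  by rewrite c_last ideal_ofE; split=> [/asboolP|?] //; apply/asboolP.
have [c01 c10] := c_lt 0%N isT.
exists (ideal_set (c 0%N)); split.
- exact/ideal_set_prime/c_prime.
- by move=> x /c01/cp.
- by move=> pc; apply: c10 => x /cp/pc.
Qed.

Lemma codimension_le1 : exists p, [/\ is_prime p, ideal_set I `<=` p &
  forall q q', is_prime q -> is_prime q' -> q' `<=` q -> ~ (q `<=` q') ->
    q `<=` p -> p `<=` q].
Proof.
have [_ [p [pp Ip nh]]] := codim1.
exists (ideal_set p); split=> //; first exact: ideal_set_prime.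
move=> q q' pq pq' q'q nqq' qp; apply: contrapT => npq; apply: nh.
pose c i := match i with
  | 0%N => ideal_of (let: And3 iq _ _ := pq' in iq)
  | 1%N => ideal_of (let: And3 iq _ _ := pq in iq)
  | _ => p end.
exists c; split=> //.
- by case=> [|[|[]]] //= _; apply: ideal_of_prime.
- case=> [|[|[]]] //= _; split.
  + by move=> x; rewrite !ideal_ofE => /asboolP/q'q ?; apply/asboolP.
  + move=> qq'; apply: nqq' => x qx.
    by have := qq' x; rewrite !ideal_ofE => H; apply/asboolP/H/asboolP.
  + by move=> x; rewrite !ideal_ofE => /asboolP/qp.
  + by move=> pq0; apply: npq => x /pq0; rewrite ideal_ofE => /asboolP.
Qed.

End Codimension.

(** * Elements b for which b s is multiplication by an element of A *)

Section Annihilator.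
Variables (A : comNzRingType) (I : ideal A) (s : {linear submodule I -> A^o}).
Local Notation Hom := {linear submodule I -> A^o}.
Hypothesis hom_gen : forall phi : Hom, exists c a : A,
  forall x, phi x = c * s x + a * val x.
Variables (E : resolution A) (m : set A).
Hypotheses (acc : max_condition (@is_ideal A)) (lm : is_local_at m).
Hypothesis faithful : forall x : A, (forall c, c \in I -> c * x = 0) -> x = 0.
Hypothesis ext_high : forall i, (1 < i)%N -> ext_van E (~` m) i (ideal_set I).

Lemma hom_linear_swap (phi : Hom) (x y : submodule I) :
  (val x : A) * phi y = (val y : A) * phi x.
Proof.
have scale (a : A) (u : submodule I) : a * phi u = phi (a *: u) by rewrite linearZ.
by rewrite !scale; congr (phi _); apply: val_inj; rewrite !linearZ; apply: mulrC.
Qed.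

(* If [b s] is multiplication by an element of [A], then [b] kills             *)
(* [Ext^1(A/I, A) = Hom(I, A)/A], even as a map to [Ext^1(A/(I : b), A)].      *)
Lemma ext1_mul_cobound (b a : A) (y : E 1%N) :
  (forall x : submodule I, b * s x = a * val x) ->
  cocycle (ideal_set I) y -> cobound (colon (ideal_set I) b) (b *: y).
Proof.
move=> bsa [Iy /res_exact[y0 dy0]].
(* For [x] in [I] the differential of [x *: y0] is [x *: y], which is 0, so [x *: y0] comes from A.
   The resulting homomorphism I -> A represents the class of [y]. *)
have mult (x : submodule I) : exists v : A, res_aug E v = (val x : A) *: y0.
  apply/res_exact0; rewrite linearZ /= dy0; apply: Iy; exact: valP.
have [f fP] := choice mult.
have lin : linear (f : submodule I -> A^o).
  move=> c x z; apply: (@res_aug_inj A E).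
  have xz : val (c *: x + z) = c * val x + val z :> A by rewrite linearP.
  by rewrite linearD linearZ /= !fP scalerA -scalerDl xz.
pose phi : Hom := HB.pack (f : submodule I -> A^o)
  (GRing.isLinear.Build A _ _ _ _ lin).
have [c [a' phiE]] := hom_gen phi.
pose k := c * a + b * a'.
have bphi (x : submodule I) : b * phi x = k * val x.
  rewrite phiE mulrDr mulrCA bsa /k mulrDl; congr (_ + _); by rewrite mulrA.
(* [b] times that homomorphism is multiplication by [k], so subtracting the image of [k] makes
   [b *: y0] killed by (I : b). *)
exists (b *: y0 - res_aug E k) => [q Iqb|]; last first.
  rewrite linearB linearZ /= dy0.
  have -> : res_diff E 0 (res_aug E k) = 0 by apply/res_exact0; exists k.
  by rewrite subr0.
pose z : submodule I := SubmoduleElt (Iqb : q * b \in I).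
rewrite scalerBr scalerA -[q * b]/(val z) -(fP z) -linearZ -linearB.
suff -> : f z - q *: (k : A^o) = 0 by rewrite linear0.
apply: faithful => x Ix; pose x' : submodule I := SubmoduleElt Ix.
rewrite mulrBr -[x]/(val x' : A) (hom_linear_swap phi x' z) -[val z]/(q * b).
rewrite -[q * b * _]mulrA bphi -[q *: _]/(q * k).
by rewrite mulrA [val x' * _]mulrC subrr.
Qed.

(** Otherwise some such (I : b) is a prime [p], at which all Ext^i with i > 1 vanish. Up to a factor
    outside [p], a class of Ext^1(A/p) is [b] times one of Ext^1(A/I), hence 0 by
    [ext1_mul_cobound]; and Ext^0(A/p) = 0 by faithfulness. So Ext^0(A) would vanish at [p]. *)
Lemma hom_multiplier_mem (b a : A) :
  (forall x : submodule I, b * s x = a * val x) -> b \in I.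
Proof.
move=> bsa; apply: contrapT => Ib.
pose J : set A := [set b | exists a, forall x : submodule I, b * s x = a * val x].
have II := ideal_setP I.
have [||{a b bsa Ib}b [a bsa] pp] := colon_prime_exists acc (X := J) II.
- by move=> c x [a' xa]; exists (c * a') => z; rewrite -!mulrA xa.
- by exists b => //; exists a.
set p := colon _ b in pp; have [ip p1 _] := pp.
have pm : p `<=` m by apply: (prime_sub_local lm).
have Smul : mul_set (~` p) by split=> // x y; apply: prime_mul.
have v2 : ext_van_all E p 2.
  apply: (ext_van_all_descend acc (l := 2) pp _ (leqnn 2)) => i li vi.
  apply: ext_van_left => //; last exact/vi/adjoin_ideal.
  by apply: ext_vanS (ext_high li) => x mx /pm.
have v1 : ext_van_all E p 1.
  apply: (ext_van_all_step acc pp v2) => z.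
  move=> /(cocycle_colon_lift II (v2 _ (adjoin_ideal b II)))[r pr [w Iw bw]].
  by exists r => //; rewrite -bw; apply: ext1_mul_cobound bsa Iw.
have v0 : ext_van_all E p 0.
  apply: (ext_van_all_step acc pp v1) => z /cocycle_aug[x <- px].
  exists 1 => //; rewrite (_ : x = 0) ?linear0 ?scaler0 //.
  by apply: faithful => c Ic; apply: px; apply: (sub_colon b II).
apply: (ext_chain_neq0 (E := E) (l := 0%N) (a := [set 0]) (p := p)) => //.
  by move=> x ->; case: ip.
exact/v0/zero_ideal.
Qed.

End Annihilator.

Lemma gorenstein_unprojection (A : comNzRingType) (I : ideal A)
    (s : {linear submodule I -> A^o}) :
  gorenstein_local_ring A -> has_codimension I 1 ->
  gorenstein_local_ring (quotient_ring I) ->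
  (forall phi : {linear submodule I -> A^o}, exists c a : A,
     forall x, phi x = c * s x + a * val x) ->
  (forall x : A, (forall c, c \in I -> c * x = 0) -> x = 0) /\
  forall b a : A, (forall x : submodule I, b * s x = a * val x) -> b \in I.
Proof.
move=> /gorenstein_local_resolution[E [m [acc lm]]] cod gorD gen.
have ge1 := codimension_ge1 cod; have le1 := codimension_le1 cod.
have faithful := codim_faithful E acc ge1.
split=> // b a; apply: (hom_multiplier_mem gen (E := E) acc lm faithful) => i.
apply: (codim_ext_van acc lm (ideal_setP I) _ ge1 le1).
exact: quotient_parameters.
Qed.

(** * Free commutative algebras *)

Lemma iso_of_same_kernel (B C D : pzRingType)
    (al : {rmorphism B -> C}) (be : {rmorphism B -> D}) :
  (forall y, exists x, al x = y) -> (forall y, exists x, be x = y) ->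
  (forall x, al x = 0 <-> be x = 0) ->
  exists2 phi : {rmorphism C -> D}, bijective phi & forall x, phi (al x) = be x.
Proof.
move=> /choice[g gK] /choice[h hK] ker.
have beE x y : al x = al y -> be x = be y.
  by move=> xy; apply/subr0_eq; rewrite -rmorphB; apply: (ker _).1; rewrite rmorphB xy subrr.
have alE x y : be x = be y -> al x = al y.
  by move=> xy; apply/subr0_eq; rewrite -rmorphB; apply: (ker _).2; rewrite rmorphB xy subrr.
have zm : zmod_morphism (be \o g).
  by move=> x y /=; rewrite -rmorphB; apply: beE; rewrite rmorphB !gK.
have mm : monoid_morphism (be \o g).
  split=> [|x y] /=; first by rewrite -(rmorph1 be); apply: beE; rewrite gK rmorph1.
  by rewrite -rmorphM; apply: beE; rewrite rmorphM !gK.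
pose phi : {rmorphism C -> D} := HB.pack (be \o g)
  (GRing.isZmodMorphism.Build _ _ _ zm) (GRing.isMonoidMorphism.Build _ _ _ mm).
exists phi => [|x]; last by apply: beE; rewrite gK.
exists (al \o h) => y /=; last by rewrite -[RHS]hK; apply: beE; rewrite gK.
by rewrite -[RHS]gK; apply: alE; rewrite hK.
Qed.

Lemma malg_mulU (K : monomType) (R : nzRingType) (c d : R) (k l : K) :
  (<< c *g k >> * << d *g l >> = << c * d *g mmul k l >> :> {malg R[K]})%R.
Proof. by rewrite malgM_def fgmulUU. Qed.

Section FreeCommutativeAlgebra.
Variables (R : comNzRingType) (M : lmodType R).
Local Notation F := (free_comalg M).

Lemma free_comalg_monomM (k l : {cmonom M}) :
  << mulcm k l >>%R = (<< k >>%R : F) * (<< l >>%R : F) :> F.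
Proof. by rewrite -[1 in LHS]mulr1; apply: (esym (malg_mulU (1 : R) 1 k l)). Qed.

Lemma free_comalg_constM (c : R) (k : {cmonom M}) :
  << c *g k >>%R = free_comalg_const M c * (<< k >>%R : F) :> F.
Proof.
have kE : mmul (onecm M) k = k by apply: mul0cm.
rewrite -[c in LHS]mulr1 -[k in LHS]kE; exact: (esym (malg_mulU c 1 (onecm M) k)).
Qed.

Lemma free_comalg_ind (P : F -> Prop) :
  (forall c, P (free_comalg_const M c)) -> (forall m, P (free_comalg_var m)) ->
  (forall x y, P x -> P y -> P (x + y)) -> (forall x y, P x -> P y -> P (x * y)) ->
  forall x, P x.
Proof.
move=> PC PV PD PM x.
have P0 : P 0 by rewrite -(rmorph0 (free_comalg_const M)).
have P1 : P 1 by rewrite -(rmorph1 (free_comalg_const M)).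
have Pm (n : nat) (m : {cmonom M}) : (mdeg m <= n)%N -> P (<< m >>%R : F).
  elim: n m => [|n IH] m; first by rewrite leqn0 mdeg_eq0 => /eqP ->.
  have [-> _ //|m1 mn] := eqVneq m (onecm M).
  have [i im] : exists i, i \in finsupp m.
    apply: contrapT => nm; case/negP: m1; apply/cmP => i.
    by rewrite onecmE; apply/eqP; rewrite cmE_eq0; apply/negP => im; apply: nm; exists i.
  pose u := divcm m (ucm i).
  have mE : m = mulcm (ucm i) u.
    apply/eqP/cmP => j; rewrite mulcmE divcmE subnKC // ucmE.
    by case: eqP => // <-; rewrite lt0n cmE_neq0.
  rewrite mE free_comalg_monomM.
  apply: PM; first exact: PV.
  by apply: IH; move: mn; rewrite {1}mE mdegM mdegU add1n ltnS.
have xE : x = \sum_(k <- msupp (x : {malg R[{cmonom M}]}))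
    (<< (x : {malg R[{cmonom M}]})@_k *g k >>%R : F).
  exact: (@monalgE {cmonom M} R x).
rewrite xE; apply: (big_ind P); [exact: P0|exact: PD|move=> m _].
rewrite free_comalg_constM.
by apply: PM; [apply: PC|apply: (Pm (mdeg m))].
Qed.

Lemma free_comalg_ext (S : pzRingType) (g h : {rmorphism F -> S}) :
  (forall c, g (free_comalg_const M c) = h (free_comalg_const M c)) ->
  (forall m, g (free_comalg_var m) = h (free_comalg_var m)) -> forall x, g x = h x.
Proof.
move=> ghC ghV; apply: free_comalg_ind => // x y ghx ghy.
  by rewrite (rmorphD g) (rmorphD h) ghx ghy.
by rewrite (rmorphM g) (rmorphM h) ghx ghy.
Qed.

Section Evaluation.
Variables (S : comNzRingType) (h : {rmorphism R -> S}) (v : M -> S).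

Definition cmonom_eval (m : {cmonom M}) : S := \prod_(i <- finsupp m) v i ^+ m i.

Lemma cmonom_evalw (m : {cmonom M}) (d : {fset M}) :
  (finsupp m `<=` d)%fset -> cmonom_eval m = \prod_(i <- d) v i ^+ m i.
Proof.
move=> le; rewrite /cmonom_eval (big_fset_incl _ le) // => i _.
by rewrite -cmE_eq0 => /eqP ->.
Qed.

Lemma cmonom_evalM (m n : {cmonom M}) :
  cmonom_eval (mulcm m n) = cmonom_eval m * cmonom_eval n.
Proof.
rewrite (cmonom_evalw (m := m) (fsubsetUl (finsupp m) (finsupp n))).
rewrite (cmonom_evalw (m := n) (fsubsetUr (finsupp m) (finsupp n))).
rewrite /cmonom_eval mdomD -big_split /=.
by apply: eq_bigr => i _; rewrite mulcmE exprD.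
Qed.

Fact cmonom_eval_mmorphism : mmorphism cmonom_eval.
Proof.
split=> [m n|]; first exact: cmonom_evalM.
by rewrite /cmonom_eval mdom1 big_seq_fset0.
Qed.
HB.instance Definition _ :=
  isMultiplicative.Build _ _ cmonom_eval cmonom_eval_mmorphism.

Definition free_comalg_eval : {rmorphism F -> S} := mmap h cmonom_eval.

Lemma free_comalg_evalC c : free_comalg_eval (free_comalg_const M c) = h c.
Proof. exact: mmapC. Qed.

Lemma free_comalg_evalX m : free_comalg_eval (free_comalg_var m) = v m.
Proof.
have -> : free_comalg_eval (free_comalg_var m) = h 1 * cmonom_eval (ucm m).
  exact: (@mmapU _ _ _ h cmonom_eval 1 (ucm m)).
by rewrite rmorph1 mul1r /cmonom_eval mdomU big_seq_fset1 cmUU expr1.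
Qed.

End Evaluation.
End FreeCommutativeAlgebra.

(** * The Kustin-Miller ideal *)

Lemma ideal_genP (R : comPzRingType) (G : set R) (a : set R) : is_ideal a ->
  G `<=` a -> forall x : R, x \in ideal_gen G -> a x.
Proof.
move=> [a0 aD aM] Ga x /asboolP[l lG ->].
elim: l lG => [|p l IH] lG; first by rewrite big_nil.
rewrite big_cons; apply: aD; first by apply/aM/Ga/lG/mem_head.
by apply: IH => q ql; apply: lG; rewrite inE ql orbT.
Qed.

Lemma sym_relations_sub (R S : comNzRingType) (M : lmodType R)
    (g : {rmorphism free_comalg M -> S}) (h : R -> S) (v : M -> S) (K : set S) :
  is_ideal K -> (forall c, g (free_comalg_const M c) = h c) ->
  (forall m, g (free_comalg_var m) = v m) ->
  (forall m n, K (v (m + n) - (v m + v n))) ->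
  (forall c m, K (v (c *: m) - h c * v m)) ->
  forall x, x \in ideal_gen (@sym_relations R M) -> K (g x).
Proof.
move=> iK gh gv vD vZ; have [K0 KD KM] := iK.
apply: (@ideal_genP (free_comalg M) _ [set x | K (g x)]).
  split=> [|x y Kx Ky|c x Kx]; rewrite /mkset.
  - by rewrite (rmorph0 g).
  - by rewrite (rmorphD g); apply: KD.
  - by rewrite (rmorphM g); apply: KM.
have gBD (x y z : free_comalg M) : g (x - (y + z)) = g x - (g y + g z).
  by rewrite (rmorphB g) (rmorphD g).
have gBM (x y z : free_comalg M) : g (x - y * z) = g x - g y * g z.
  by rewrite (rmorphB g) (rmorphM g).
move=> _ [[m [n ->]]|[c [m ->]]]; rewrite /mkset.
  move: (vD m n); rewrite -(gv (m + n)) -(gv m) -(gv n).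
  by rewrite -(gBD (free_comalg_var (m + n)) (free_comalg_var m) (free_comalg_var n)).
move: (vZ c m); rewrite -(gv (c *: m)) -(gv m) -(gh c).
by rewrite -(gBM (free_comalg_var (c *: m)) (free_comalg_const M c) (free_comalg_var m)).
Qed.

Lemma rmorph_comb (S T : pzRingType) (g : {rmorphism S -> T}) x y z w :
  g (x * y + z * w) = g x * g y + g z * g w.
Proof. by rewrite rmorphD !rmorphM. Qed.

Lemma comb_cancel (R : comPzRingType) (z u v w : R) :
  z = 0 -> u * v + z = z * v + w -> v * u - w = 0.
Proof. by move=> ->; rewrite mul0r addr0 add0r mulrC => ->; rewrite subrr. Qed.

Lemma rmorphB1 (S T : pzRingType) (g : {rmorphism S -> T}) x y :
  g x = y -> g (x - 1) = y - 1.
Proof. by move=> <-; rewrite rmorphB rmorph1. Qed.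

(* The next lemmas are stated over abstract rings because rewriting in [Sym]   *)
(* and [free_comalg] may unfold their construction and not terminate.          *)
Lemma rmorphMD (S T : pzRingType) (g : {rmorphism S -> T}) x y z y' z' :
  g y = y' -> g z = z' -> g (x * y + z) = g x * y' + z'.
Proof. by move=> <- <-; rewrite rmorphD rmorphM. Qed.

Section KustinMiller.
Variables (O : comNzRingType) (I : ideal O) (r : nat) (f : 'I_r -> submodule I).
Variable s : {linear submodule I -> O^o}.
Hypothesis fI : I =i ideal_gen [set x : O | exists j, x = val (f j)].

Local Notation KM := (KM_ideal s f).

Definition KM_elt (a : submodule I) : {poly O} :=
  'X * (val a : O)%:P - (s a : O)%:P.

Let v0 : val (0 : submodule I) = 0 :> O. Proof. by rewrite linear0. Qed.
Let s0 : s 0 = 0 :> O. Proof. by rewrite linear0. Qed.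
Let vD x y : val (x + y : submodule I) = val x + val y :> O.
Proof. by rewrite linearD. Qed.
Let sD x y : s (x + y) = s x + s y :> O. Proof. by rewrite linearD. Qed.
Let vZ c x : val (c *: x : submodule I) = c * val x :> O.
Proof. by rewrite linearZ. Qed.
Let sZ c x : s (c *: x) = c * s x :> O. Proof. by rewrite linearZ. Qed.

Let KM_set : is_ideal [set p : {poly O} | p \in KM].
Proof. exact: ideal_setP. Qed.

Lemma KM_elt_mem (a : submodule I) : KM_elt a \in KM.
Proof.
have [K0 KD KMul] := KM_set.
have eltD (c : O) (x y : submodule I) :
    KM_elt (c *: x + y) = c%:P * KM_elt x + KM_elt y.
  by rewrite /KM_elt vD vZ sD sZ !polyCD !polyCM; ring.
have elt0 : KM_elt 0 = 0 by rewrite /KM_elt v0 s0 polyC0 mulr0 subr0.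
pose good : set O := [set x | exists2 b : submodule I, val b = x & KM_elt b \in KM].
have [] : good (val a); last by move=> b /val_inj ->.
apply: (ideal_genP (G := [set x : O | exists j, x = val (f j)])); last first.
- by rewrite -fI; apply: valP.
- by move=> x [j ->]; exists (f j) => //; apply: mem_ideal_gen; exists j.
split=> [|x y [b <- bK] [b' <- b'K]|c x [b <- bK]].
- by exists 0; [rewrite linear0|rewrite elt0].
- exists (b + b'); first by rewrite linearD.
  by have := eltD 1 b b'; rewrite scale1r mul1r => ->; apply: KD.
- exists (c *: b); first by rewrite linearZ.
  by have := eltD c b 0; rewrite addr0 elt0 addr0 => ->; apply: KMul.
Qed.

(* Elements of the ideal are the sums of the [S^k (S a_k - s a_k)], [a_k] in   *)
(* [I]; this describes their coefficients.                                     *)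
Lemma KM_coef (p : {poly O}) : p \in KM -> exists (a : nat -> submodule I) (N : nat),
  (forall k, (N <= k)%N -> a k = 0) /\
  forall k, p`_k = (if k is j.+1 then val (a j) : O else 0) - s (a k).
Proof.
pose Q : set {poly O} := [set p | exists (a : nat -> submodule I) (N : nat),
  (forall k, (N <= k)%N -> a k = 0) /\
  forall k, p`_k = (if k is j.+1 then val (a j) : O else 0) - s (a k)].
have Q0 : Q 0.
  exists (fun _ => 0), 0%N; split=> // k.
  by rewrite coef0 s0 subr0; case: k => // k; rewrite v0.
have QD x y : Q x -> Q y -> Q (x + y).
  move=> [a [N [a0 ax]]] [b [M [b0 bx]]].
  exists (fun k => a k + b k), (maxn N M); split=> k.
    by rewrite geq_max => /andP[/a0 -> /b0 ->]; rewrite addr0.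
  rewrite coefD ax bx sD.
  by case: k => [|k]; rewrite ?vD; ring.
have QC (c : O) x : Q x -> Q (c%:P * x).
  move=> [a [N [a0 ax]]]; exists (fun k => c *: a k), N; split=> [k /a0 ->|k].
    by rewrite scaler0.
  by rewrite coefCM ax sZ; case: k => [|k]; rewrite ?vZ; ring.
have QX x : Q x -> Q (x * 'X).
  move=> [a [N [a0 ax]]].
  exists (fun k => if k is j.+1 then a j else 0), N.+1; split=> [[//|k] /a0 //|k].
  rewrite coefMX; case: k => [|k] /=; first by rewrite s0 subrr.
  by rewrite ax; case: k => [|k] //=; rewrite v0.
apply: (@ideal_genP {poly O} _ Q).
  split=> // c x Qx; elim/poly_ind: c => [|c d IH]; first by rewrite mul0r.
  by rewrite mulrDl mulrAC; apply: QD; [apply: QX|apply: QC].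
move=> _ [j ->]; exists (fun k => if k == 0%N then f j else 0), 1%N; split=> [[]//|k].
by rewrite coefB coefXM !coefC; case: k => [|[|k]] /=; rewrite ?v0 ?s0 ?subr0.
Qed.

(** In positive degree the leading coefficient of [p] lies in [I], because its product with [t] does
    and [t] is regular on O/I; subtracting some S^n (S b - s(b)) lowers the degree. For constant
    [p], [t] times it is 0. *)
Lemma KM_torsion_free (t : O) (p : {poly O}) : biregular I t ->
  t%:P * p \in KM -> p \in KM.
Proof.
have [K0 KD KMul] := KM_set.
move=> [tO tD]; have [n] := ubnP (size p); elim: n p => [//|n IH] p.
rewrite ltnS => pn tpK; have [a [N [a0 ax]]] := KM_coef tpK.
have tO0 x : t * x = 0 -> x = 0.
  by move=> tx; apply: contrapT => x0; apply: (tO x x0).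
have tI x : t * x \in I -> x \in I.
  move=> tx; apply/quotient_proj_eq0; apply: contrapT => x0; apply: (tD _ x0).
  have -> : t *: quotient_proj I x = quotient_pi I (t *: (x : O^o)).
    exact/esym/linearZ.
  exact/quotient_proj_eq0.
(* Descending from [N]: once [a k.+1] is 0, [val (a k)] is the coefficient of degree k + 1 of
   [t%:P * p], which is beyond its degree. *)
have an k : (n <= k.+1)%N -> a k = 0.
  have [d] := ubnP (N - k)%N; elim: d k => [//|d IHd] k kd nk.
  have [/a0//|kN] := leqP N k.
  have ak1 : a k.+1 = 0.
    apply: IHd; last exact: leqW.
    by rewrite subnS; move: kd; rewrite -subn_gt0 in kN; case: (N - k)%N kN.
  apply: val_inj; rewrite v0.
  have := ax k.+1; rewrite ak1 s0 subr0 => <-.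
  by rewrite coefCM nth_default ?mulr0 //; apply: leq_trans pn nk.
case: n IH pn an => [|[|n]] IH pn an.
- suff -> : p = 0 by [].
  by apply/eqP; rewrite -size_poly_leq0.
- suff -> : p = 0 by [].
  rewrite (size1_polyC pn); have := ax 0%N; rewrite an // s0 subr0 coefCM.
  by move=> /tO0 ->; rewrite polyC0.
have bI : p`_n.+1 \in I.
  apply: tI; have := ax n.+1; rewrite coefCM (an n.+1) // s0 subr0 => ->.
  exact: valP.
pose q := 'X^n * KM_elt (SubmoduleElt bI).
have qK : q \in KM by apply/KMul/KM_elt_mem.
rewrite -(subrK q p); apply: KD => //; apply: IH.
  rewrite ltnS; apply/leq_sizeP => k nk; rewrite coefB coefXnM ltnNge (ltnW nk) /=.
  rewrite coefB coefXM !coefC; case: (ltngtP n.+1 k) nk => // [nk _|<- _].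
    rewrite nth_default; last exact: leq_trans pn nk.
    have -> : (k - n = (k - n.+2).+2)%N.
      by rewrite -subSS -subSn ?subSS -?subSn // ltnW.
    by rewrite subr0 subrr.
  by rewrite subSn // subnn /= subr0 subrr.
by rewrite mulrBr; apply: (is_idealB KM_set tpK); apply: KMul.
Qed.


(** * Identification of R_1 with the Kustin-Miller ring *)

Local Notation Hom := {linear submodule I -> O^o}.
Local Notation incl := (ideal_incl I).
Local Notation F := (free_comalg Hom).

Hypothesis hom_gen : forall phi : Hom, exists c a : O,
  forall x, phi x = c * s x + a * val x.
Hypothesis faithful : forall x : O, (forall c, c \in I -> c * x = 0) -> x = 0.
Hypothesis multiplier : forall b a : O,
  (forall x : submodule I, b * s x = a * val x) -> b \in I.

Definition lin_poly (c a : O) : {poly O} := c%:P * 'X + a%:P.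

(** Since (c - c') s = a' - a on [I], the element b = c - c' lies in [I], and s(b) = a' - a by
    faithfulness; the difference is then S b - s(b). *)
Lemma lin_poly_KM (c a c' a' : O) :
  (forall x : submodule I, c * s x + a * val x = c' * s x + a' * val x) ->
  lin_poly c a - lin_poly c' a' \in KM.
Proof.
move=> eq_hom.
have ccI : c - c' \in I.
  apply: (multiplier (a := a' - a)) => x; apply/eqP; rewrite -subr_eq0; apply/eqP.
  have -> : (c - c') * s x - (a' - a) * val x =
    (c * s x + a * val x) - (c' * s x + a' * val x) :> O by ring.
  by rewrite eq_hom subrr.
pose b : submodule I := SubmoduleElt ccI.
have sb : s b = a' - a :> O.
  apply/subr0_eq; apply: faithful => x Ix; pose x' : submodule I := SubmoduleElt Ix.
  have swap : x * s b = (c - c') * s x' := hom_linear_swap s x' b.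
  have -> : x * (s b - (a' - a)) =
    (c * s x' + a * x) - (c' * s x' + a' * x) by rewrite mulrBr swap; ring.
  by rewrite (eq_hom x') subrr.
have -> : lin_poly c a - lin_poly c' a' = KM_elt b.
  by rewrite /KM_elt sb /lin_poly !polyCB; ring.
exact: KM_elt_mem.
Qed.

Lemma hom_coef_exists : exists ca : Hom -> O * O,
  forall (phi : Hom) x, phi x = (ca phi).1 * s x + (ca phi).2 * val x :> O.
Proof.
have [|g gP] := @choice Hom (O * O)%type (fun phi ca =>
    forall x, phi x = ca.1 * s x + ca.2 * val x :> O).
  by move=> phi; have [c [a phiE]] := hom_gen phi; exists (c, a).
by exists g => phi x; apply: gP.
Qed.

Local Notation ca := (sval (cid hom_coef_exists)).

Lemma caP (phi : Hom) x : phi x = (ca phi).1 * s x + (ca phi).2 * val x :> O.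
Proof. exact: (svalP (cid hom_coef_exists)). Qed.

Definition hom_poly (phi : Hom) : {poly O} := lin_poly (ca phi).1 (ca phi).2.

(** Defined on the free algebra because the coefficients of each homomorphism are chosen
    arbitrarily: the relations of [Sym] hold only modulo the Kustin-Miller ideal. *)
Definition unproj_lift : {rmorphism F -> {poly O}} :=
  free_comalg_eval (polyC : {rmorphism O -> {poly O}}) hom_poly.

Lemma unproj_liftX (phi : Hom) : unproj_lift (free_comalg_var phi) = hom_poly phi.
Proof. exact: free_comalg_evalX. Qed.

Lemma unproj_liftC (c : O) : unproj_lift (free_comalg_const Hom c) = c%:P.
Proof. exact: free_comalg_evalC. Qed.

Lemma unproj_lift_rel (u : F) : u \in ideal_gen (@sym_relations O Hom) ->
  unproj_lift u \in KM.
Proof.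
apply: (sym_relations_sub KM_set unproj_liftC unproj_liftX) => [phi psi|c phi].
  have -> : hom_poly phi + hom_poly psi =
      lin_poly ((ca phi).1 + (ca psi).1) ((ca phi).2 + (ca psi).2).
    by rewrite /hom_poly /lin_poly !polyCD; ring.
  apply: lin_poly_KM => x; rewrite -(caP (phi + psi) x).
  have -> : (phi + psi) x = phi x + psi x :> O by exact: (hom_addE phi psi x).
  by rewrite (caP phi x) (caP psi x); ring.
have -> : c%:P * hom_poly phi = lin_poly (c * (ca phi).1) (c * (ca phi).2).
  by rewrite /hom_poly /lin_poly !polyCM; ring.
apply: lin_poly_KM => x; rewrite -(caP (c *: phi) x).
have -> : (c *: phi) x = c * phi x :> O by exact: (hom_scaleE c phi x).
by rewrite (caP phi x); ring.
Qed.

Lemma hom_poly_KM (phi : Hom) (c a : O) :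
  (forall x, phi x = c * s x + a * val x) -> hom_poly phi - lin_poly c a \in KM.
Proof. by move=> phiE; apply: lin_poly_KM => x; rewrite -(caP phi x) phiE. Qed.

Local Notation R1 := (unproj_ring1 I).

Definition unproj_class (x : F) : R1 :=
  unproj_ring1_proj I (quotient_proj (ideal_gen (@sym_relations O Hom)) x).

Definition unproj_eval : {rmorphism {poly O} -> R1} :=
  poly_eval (unproj_ring1_const I) (unproj_class (free_comalg_var s)).

Lemma unproj_class_onto y : exists x, unproj_class x = y.
Proof.
have [z <-] := quotient_projP y; have [x <-] := quotient_projP z.
by exists x.
Qed.

Lemma unproj_class_incl : unproj_class (free_comalg_var incl) = 1.
Proof.
rewrite -(rmorph1 (unproj_ring1_proj I)); apply/quotient_proj_eq.
exact: mem_ideal_gen.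
Qed.

Lemma unproj_class_comb (phi : Hom) (c a : O) :
  (forall x, phi x = c * s x + a * val x) ->
  unproj_class (free_comalg_var phi) =
    unproj_ring1_const I c * unproj_class (free_comalg_var s) + unproj_ring1_const I a.
Proof.
move=> phiE; have -> : phi = c *: s + a *: incl.
  by apply: linear_ext => x; rewrite hom_addE !hom_scaleE phiE.
have combE : Sym_var (c *: s + a *: incl) =
    Sym_const Hom c * Sym_var s + Sym_const Hom a * Sym_var incl.
  by rewrite (Sym_varD (c *: s) (a *: incl)) (Sym_varZ c s) (Sym_varZ a incl).
apply: (etrans (congr1 (unproj_ring1_proj I) combE)).
apply: (etrans (rmorph_comb _ _ _ _ _)); apply: congr1.
exact: (etrans (congr1 (fun y => unproj_ring1_const I a * y) unproj_class_incl) (mulr1 _)).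
Qed.

Lemma unproj_eval_lin (c a : O) : unproj_eval (lin_poly c a) =
  unproj_ring1_const I c * unproj_class (free_comalg_var s) + unproj_ring1_const I a.
Proof.
rewrite /lin_poly (rmorphD unproj_eval) (rmorphM unproj_eval).
by rewrite [unproj_eval 'X]poly_evalX ![unproj_eval _%:P]poly_evalC.
Qed.

Lemma unproj_eval_lift x : unproj_eval (unproj_lift x) = unproj_class x.
Proof.
apply: (free_comalg_ext (g := unproj_eval \o unproj_lift)
  (h := unproj_ring1_proj I \o quotient_proj (ideal_gen (@sym_relations O Hom)))).
- by move=> c; apply: (etrans (congr1 unproj_eval (unproj_liftC c))); apply: poly_evalC.
- move=> phi; apply: (etrans (congr1 unproj_eval (unproj_liftX phi))).
  apply: (etrans (unproj_eval_lin _ _)).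
  exact: (esym (unproj_class_comb (caP phi))).
Qed.

Lemma unproj_eval_KM (p : {poly O}) : p \in KM -> unproj_eval p = 0.
Proof.
apply: (@ideal_genP {poly O} _ [set p | unproj_eval p = 0]).
  split=> [|x y hx hy|c x hx]; rewrite /mkset.
  - exact: (rmorph0 unproj_eval).
  - by rewrite (rmorphD unproj_eval) hx hy addr0.
  - by rewrite (rmorphM unproj_eval) hx mulr0.
move=> _ [j ->]; rewrite /mkset (rmorphB unproj_eval) (rmorphM unproj_eval) [unproj_eval 'X]poly_evalX ![unproj_eval _%:P]poly_evalC.
(* f_j s is also multiplication by s(f_j); comparing the classes of its two expressions c s + a
   gives S f_j = g_j in R_1. *)
pose phi : Hom := (val (f j) : O) *: s.
have phi1 x : phi x = (val (f j) : O) * s x + 0 * val x :> O.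
  by rewrite mul0r addr0.
have phi2 x : phi x = 0 * s x + (s (f j) : O) * val x :> O.
  by rewrite mul0r add0r [LHS](hom_linear_swap s (f j) x) mulrC.
apply: (comb_cancel (rmorph0 (unproj_ring1_const I))).
exact: (etrans (esym (unproj_class_comb phi1)) (unproj_class_comb phi2)).
Qed.

Lemma unproj_class_eq0 (x : F) : unproj_class x = 0 -> unproj_lift x \in KM.
Proof.
have [K0 KD KMul] := KM_set.
pose pi : {rmorphism F -> Sym Hom} := quotient_proj (ideal_gen (@sym_relations O Hom)).
have lift_eq x1 y1 : pi x1 = pi y1 -> unproj_lift y1 \in KM -> unproj_lift x1 \in KM.
  move=> /quotient_proj_eq/unproj_lift_rel; rewrite (rmorphB unproj_lift) => xyK yK.
  by rewrite -(subrK (unproj_lift y1) (unproj_lift x1)); apply: KD.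
move=> /quotient_proj_eq0 x0.
suff [y xy yK] : exists2 y, pi y = pi x & unproj_lift y \in KM.
  exact: (lift_eq x y (esym xy) yK).
move: x0; apply: (@ideal_genP (Sym Hom) _
  [set z | exists2 y, pi y = z & unproj_lift y \in KM]).
  split=> [|z1 z2 [y1 <- y1K] [y2 <- y2K]|c z [y <- yK]].
  - by exists 0; [exact: (rmorph0 pi)|rewrite (rmorph0 unproj_lift)].
  - exists (y1 + y2); first exact: (rmorphD pi).
    by rewrite (rmorphD unproj_lift); apply: KD.
  - have [b <-] := quotient_projP c.
    exists (b * y); first exact: (rmorphM pi).
    by rewrite (rmorphM unproj_lift); apply: KMul.
move=> z ->; exists (free_comalg_var incl - 1).
  exact: (rmorphB1 (g := pi) erefl).
rewrite (rmorphB1 (unproj_liftX incl)).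
have -> : (1 : {poly O}) = lin_poly 0 1 by rewrite /lin_poly polyC0 mul0r add0r.
by apply: hom_poly_KM => y; rewrite mul0r add0r mul1r.
Qed.

Lemma unproj_eval_onto y : exists p, unproj_eval p = y.
Proof.
have [x <-] := unproj_class_onto y; exists (unproj_lift x).
exact: unproj_eval_lift.
Qed.

Lemma unproj_eval_eq0 (p : {poly O}) : unproj_eval p = 0 <-> p \in KM.
Proof.
split; last exact: unproj_eval_KM.
have [K0 KD KMul] := KM_set.
(* The lift of [s] is congruent to ['X], so every polynomial is a lift modulo the ideal. *)
have [x xp] : exists x, p - unproj_lift x \in KM.
  elim/poly_ind: p => [|p c [x xp]]; first by exists 0; rewrite rmorph0 subr0.
  exists (x * free_comalg_var s + free_comalg_const Hom c).
  rewrite (rmorphMD x (unproj_liftX s) (unproj_liftC c)).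
  have -> : p * 'X + c%:P - (unproj_lift x * hom_poly s + c%:P) =
    'X * (p - unproj_lift x) + (- unproj_lift x) * (hom_poly s - 'X) by ring.
  apply: KD; first exact: KMul.
  apply: KMul; have -> : 'X = lin_poly 1 0 by rewrite /lin_poly polyC0 polyC1 mul1r addr0.
  by apply: hom_poly_KM => y; rewrite mul1r mul0r addr0.
move=> p0; rewrite -(subrK (unproj_lift x) p); apply: KD => //.
apply: unproj_class_eq0; rewrite -unproj_eval_lift; apply/eqP.
by rewrite -subr_eq0 -[X in _ - X]p0 -rmorphB -opprB rmorphN unproj_eval_KM // oppr0.
Qed.

(** Carries [KM_torsion_free] over to R_1, where it says J = 0. *)
Lemma unpr_torsion0 (u : R1) : u \in @unpr_torsion O I -> u = 0.
Proof.
move=> /asboolP[t tT]; have [p <-] := unproj_eval_onto u.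
have -> : unproj_ring1_const I t = unproj_eval t%:P by rewrite [RHS]poly_evalC.
by rewrite -rmorphM => /unproj_eval_eq0/(KM_torsion_free tT)/unproj_eval_eq0.
Qed.

Lemma psi2E (p : {poly O}) : psi2 s p = unpr_proj I (unproj_eval p).
Proof.
rewrite [RHS]rmorph_sum; apply: eq_bigr => i _.
by rewrite rmorphM rmorphXn.
Qed.

Lemma unpr_proj_eq0 (u : R1) : unpr_proj I u = 0 <-> u = 0.
Proof.
split=> [/quotient_proj_eq0/unpr_torsion0|->] //; exact: rmorph0.
Qed.

Lemma psi2_onto y : exists p, psi2 s p = y.
Proof.
have [u <-] := quotient_projP y; have [p <-] := unproj_eval_onto u.
by exists p; rewrite psi2E.
Qed.

Lemma psi2_eq0 p : psi2 s p = 0 <-> p \in KM.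
Proof. by rewrite psi2E unpr_proj_eq0; apply: unproj_eval_eq0. Qed.

Lemma unpr_KM_iso : algebra_iso (unpr_const I) (KM_const s f).
Proof.
have [||p|phi bij phiE] := iso_of_same_kernel (al := psi2 s) (be := quotient_proj KM).
- exact: psi2_onto.
- exact: quotient_projP.
- by rewrite psi2_eq0 quotient_proj_eq0.
exists phi => // c; rewrite -[RHS]phiE; congr (phi _).
by rewrite [RHS]poly_evalC.
Qed.

Lemma unpr_ring1_iso : algebra_iso (unpr_const I) (unproj_ring1_const I).
Proof.
have [||u|phi bij phiE] := iso_of_same_kernel (al := unpr_proj I) (be := idfun).
- exact: quotient_projP.
- by move=> y; exists y.
- exact: unpr_proj_eq0.
by exists phi => // c; rewrite phiE.
Qed.

End KustinMiller.

Theorem theorem5p3 (O : comNzRingType) (I : ideal O) (r : nat)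
    (f : 'I_r -> submodule I) (s : {linear submodule I -> O^o}) :
  gorenstein_local_ring O ->
  I =i ideal_gen [set x : O | exists j, x = val (f j)] ->
  has_codimension I 1 ->
  gorenstein_local_ring (quotient_ring I) ->
  injective s ->
  (forall q : quotient_module (mul_homs I),
     exists a : O, q = a *: quotient_pi (mul_homs I) s) ->
  [/\ forall y : unpr I, exists p : {poly O}, psi2 s p = y,
      forall p : {poly O}, psi2 s p = 0 <-> p \in KM_ideal s f,
      algebra_iso (unpr_const I) (KM_const s f)
    & algebra_iso (unpr_const I) (unproj_ring1_const I)].
Proof.
move=> gorO fI codI gorD _ s_gen.
have hom_gen (phi : {linear submodule I -> O^o}) : exists c a : O,
    forall x, phi x = c * s x + a * val x.
  have [c phic] := s_gen (quotient_pi (mul_homs I) phi); exists c.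
  move: phic; rewrite -linearZ => /quotient_pi_eq/asboolP[a phiE]; exists a => x.
  have /(congr1 (fun h : {linear submodule I -> O^o} => (h x : O))) := phiE.
  have -> : (phi - c *: s) x = phi x - c * s x :> O by [].
  by move=> /eqP; rewrite subr_eq addrC => /eqP.
have [faithful mult] := gorenstein_unprojection gorO codI gorD hom_gen.
split.
- exact: psi2_onto hom_gen.
- exact: psi2_eq0 fI hom_gen faithful mult.
- exact: unpr_KM_iso fI hom_gen faithful mult.
- exact: unpr_ring1_iso fI hom_gen faithful mult.
Qed.
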